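(* Fix $k\ge1$. There exist constants $C_k'$ and $c_k$, depending only on $k$, such that for all $x\ge1$ and $C_k'\le y_1\le\cdots\le y_k$ with $2^ky_1\cdots y_k\le x/y_k$, $$\frac{H^{(k+1)}(x,\mathbf{y},2\mathbf{y})}{x}\ll_k\left(\prod_{i=1}^k(\log y_i)^{-e_{k,i}}\right)\sum_{\substack{\mathbf{a}\in\mathscr{P}_*^k(\mathbf{y})\\ a_i\le y_i^{c_k}\ (1\le i\le k)}}\frac{L^{(k+1)}(\mathbf{a})}{a_1\cdots a_k}.$$
   Context: $H^{(k+1)}(x,\mathbf{y},\mathbf{z})$ is the number of positive integers $n\le x$ for which there exist positive integers $d_1,\dots,d_k$ with $d_1\cdots d_k\mid n$ and $y_i<d_i\le z_i$; $2\mathbf{y}=(2y_1,\dots,2y_k)$. $(e_{k,1},\dots,e_{k,k})=(1,\dots,1,2)$ (the first $k-1$ entries equal $1$, the last equals $2$). $L^{(k+1)}(\mathbf{a})$ is the $k$-dimensional Lebesgue measure of $\bigcup[\log(d_1/2),\log d_1)\times\cdots\times[\log(d_k/2),\log d_k)$ over all $(d_1,\dots,d_k)\in\mathbb{N}^k$ with $d_1\cdots d_i\mid a_1\cdots a_i$ for all $i$. $\mathscr{P}_*(y,z)$ is the set of squarefree positive integers whose prime factors all lie in $(y,z]$; with $t_0=1$, $\mathscr{P}_*^k(\mathbf{t})=\{\mathbf{a}\in\mathbb{N}^k: a_i\in\mathscr{P}_*(t_{i-1},t_i)\ (1\le i\le k)\}$. *)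

(* Defs.v *)
(* Vectors of the paper (y_1..y_k, a_1..a_k,
   d_1..d_k) are represented as functions on nat, only indices 1..k are used. *)
From HB Require Import structures.
From mathcomp Require Import all_boot all_order all_algebra.
From mathcomp Require Import all_classical all_reals all_analysis.
Set Implicit Arguments. Unset Strict Implicit. Unset Printing Implicit Defensive.
Import Order.TTheory GRing.Theory Num.Theory.
Local Open Scope ring_scope.

Section Defs.
Variable R : realType.

(* H^{(k+1)}(x, y, z): number of positive integers n <= x such that there are
   positive integers d_1..d_k with d_1...d_k | n and y_i < d_i <= z_i.
   (Any such d_i divides n, hence d_i <= n, so searching d_i < n+1 is complete.) *)
Definition Hcount (k : nat) (x : R) (y z : nat -> R) : nat :=
  count (fun n : nat =>
    [exists d : {ffun 'I_k -> 'I_n.+1},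
       ((\prod_(i : 'I_k) (d i : nat)) %| n)%N &&
       [forall i : 'I_k, (0 < (d i : nat))%N && (y i.+1 < (d i)%:R) && ((d i)%:R <= z i.+1)]])
    (iota 1 (Num.truncn x)).

Definition squarefree (a : nat) : Prop :=
  (0 < a)%N /\ forall p : nat, prime p -> ~ (p * p %| a)%N.
Definition Pstar (lo hi : R) (a : nat) : Prop :=
  squarefree a /\ forall p : nat, prime p -> (p %| a)%N -> lo < p%:R /\ p%:R <= hi.

Definition tprev (t : nat -> R) (i : nat) : R := if i == 1%N then 1 else t i.-1.

Definition Pstark (k : nat) (t : nat -> R) (a : nat -> nat) : Prop :=
  forall i : nat, (1 <= i <= k)%N -> Pstar (tprev t i) (t i) (a i).

(* k-dimensional Lebesgue measure of a set of points of R^k (encoded as lists of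
   length k), defined as the iterated integral of its indicator function
   (Tonelli): lebk 0 U = 1_U([]), lebk (n+1) U = \int (lebk n U_t) dt. *)
Fixpoint lebk (n : nat) (U : set (seq R)) : \bar R :=
  match n with
  | 0%N => ((asbool (U [::]))%:R)%:E
  | n'.+1 => (\int[@lebesgue_measure R]_(t in setT) lebk n' [set s | U (t :: s)])%E
  end.

Definition Lset (k : nat) (a : nat -> nat) : set (seq R) :=
  [set s | size s = k /\
     exists d : nat -> nat,
       (forall i, (1 <= i <= k)%N ->
          (0 < d i)%N /\ (\prod_(1 <= j < i.+1) d j %| \prod_(1 <= j < i.+1) a j)%N) /\
       (forall i, (i < k)%N ->
          ln ((d i.+1)%:R / 2) <= nth 0 s i /\ nth 0 s i < ln ((d i.+1)%:R))].

Definition Lk (k : nat) (a : nat -> nat) : R := fine (lebk k (Lset k a)).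

Definition ek (k i : nat) : nat := if i == k then 2%N else 1%N.

Definition vec_of (k B : nat) (f : {ffun 'I_k -> 'I_B}) : nat -> nat :=
  fun i => if i == 0%N then 0%N else nth 0%N [seq (f j : nat) | j <- enum 'I_k] i.-1.

(* the bound for the a_i : a_i <= y_i^c implies a_i < abound *)
Definition abound (k : nat) (y : nat -> R) (c : R) : nat :=
  (\sum_(1 <= i < k.+1) Num.truncn (y i `^ c)).+1.

Definition Lsum (k : nat) (y : nat -> R) (c : R) : R :=
  \sum_(f : {ffun 'I_k -> 'I_(abound k y c)} |
        asbool (Pstark k y (vec_of f) /\
                forall i, (1 <= i <= k)%N -> (vec_of f i)%:R <= y i `^ c))
     Lk k (vec_of f) / (\prod_(1 <= i < k.+1) vec_of f i)%:R.

End Defs.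

(* Main.v *)
Require Import Defs.
From HB Require Import structures.
From mathcomp Require Import all_boot all_order all_algebra.
From mathcomp Require Import all_classical all_reals all_analysis.
From mathcomp Require Import measurable_realfun ring lra zify.
Set Implicit Arguments. Unset Strict Implicit. Unset Printing Implicit Defensive.
Import Order.TTheory GRing.Theory Num.Theory.
Local Open Scope ring_scope.

(** Let [n <= x] have divisors [d_i] in [(y_i, 2 y_i]] with product dividing [n] and
    cofactor [f].  Unless [n] is smaller than [x / sqrt (y_k)], every [ln d_i] is at
    least [ln y_i] and [ln f >> ln x].  Expanding [ln f * prod (ln d_i)] with
    [ln = sum of the von Mangoldt function] over [q_0 | f] and [q_i | d_i], and writing
    [n = m q_0 q_1 ... q_k], Chebyshev's bound disposes of [q_0] and confines, for
    fixed [m], the sum over the [q_i] to one factor [O(1)] for each dyadic cell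
    occupied by a tuple [(g_i)] with [g_1 ... g_k | m].  No sieve is needed: this gives
    [H << x / sqrt (y_k) + x / (ln x * prod (ln y_i)) * sum_(m <= x) N(m) / m], where
    [N(m)] is the number of occupied cells.

    Since [N(a r) <= (2 tau(r))^k N(a)], the square part of [m] and its primes in
    [(y_i, 2 y_i]] cost only constants; the primes above [2 y_k] cost a factor
    [O(ln x / ln y_k)], because [(sum_(a <= z) 1/a) (sum_b 1/b) <= sum_(n <= x z) 1/n]
    when [b] runs over the integers up to [x] without prime factors up to [z].  What
    remains is the sum of [N(a) / a] over squarefree [a = a_1 ... a_k], and Markov's
    inequality applied to [ln a_i], the sum of [ln p] over [p | a_i], restricts it to
    [a_i <= y_i ^ c].  Finally [N(a)] is at most a constant times [L(a)]: boxes of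
    side [ln 2] attached to distinct dyadic cells overlap boundedly often. *)

(** * The von Mangoldt function and Chebyshev's bound *)

Section Mangoldt.
Variable R : realType.
Implicit Types (m n p q B : nat).

(** The von Mangoldt function: [q > 1] is a prime power exactly when it equals the full power of its
    least prime factor that divides it. *)
Definition mangoldt q : R :=
  if (q == pdiv q ^ logn (pdiv q) q)%N && (1 < q)%N then ln (pdiv q)%:R else 0.

Lemma ln_nat_ge0 n : 0 <= ln (n%:R : R).
Proof.
case: n => [|n]; first by rewrite ln0.
by apply: ln_ge0; rewrite ler1n.
Qed.

Lemma mangoldt_ge0 q : 0 <= mangoldt q.
Proof. by rewrite /mangoldt; case: ifP => // _; exact: ln_nat_ge0. Qed.

Lemma mangoldt_pfactor p e : prime p -> mangoldt (p ^ e.+1) = ln p%:R.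
Proof.
move=> pp; rewrite /mangoldt pdiv_pfactor // pfactorK // eqxx /=.
by rewrite (leq_trans (prime_gt1 pp)) // -{1}(expn1 p) leq_exp2l ?prime_gt1.
Qed.

Lemma mangoldt_neq0 q : mangoldt q != 0 ->
  exists p e, prime p /\ q = (p ^ e.+1)%N.
Proof.
rewrite /mangoldt; case: ifP => [/andP[/eqP qE q1] _|_]; last by rewrite eqxx.
have pp : prime (pdiv q) by rewrite pdiv_prime.
exists (pdiv q), (logn (pdiv q) q).-1; split => //.
by rewrite prednK // logn_gt0 mem_primes pp pdiv_dvd (ltnW q1).
Qed.

(** Strong induction, removing the least prime factor: passing from [n] to [m = n * p] adds exactly
    one prime-power divisor, [p ^ (logn p n).+1], which contributes [ln p]. *)
Lemma ln_sum_mangoldt m B : (0 < m < B)%N ->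
  ln m%:R = \sum_(1 <= q < B | (q %| m)%N) mangoldt q.
Proof.
elim/ltn_ind: m => m IH /andP[m0 mB].
have [m1|m1] := leqP m 1.
  have -> : m = 1%N by lia.
  rewrite ln1 big1 // => q; rewrite dvdn1 => /eqP ->.
  by rewrite /mangoldt.
have pp : prime (pdiv m) by rewrite pdiv_prime.
set p := pdiv m in pp.
have /dvdnP[n mE] : (p %| m)%N by exact: pdiv_dvd.
have n0 : (0 < n)%N by move: m0; rewrite mE muln_gt0 => /andP[].
have p1 := prime_gt1 pp.
have nm : (n < m)%N by rewrite mE ltn_Pmulr.
have E q : (1 <= q < B)%N -> (if (q %| m)%N then mangoldt q else 0) =
   (if (q %| n)%N then mangoldt q else 0) +
   (if q == (p ^ (logn p n).+1)%N then mangoldt q else 0).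
  move=> _; have [->|/mangoldt_neq0[r [e [rp ->]]]] := eqVneq (mangoldt q) 0.
    by rewrite !if_same addr0.
  rewrite mE !pfactor_dvdn // ?muln_gt0 ?n0 ?(ltnW p1) // lognM // ?(ltnW p1) //.
  rewrite (logn_prime _ pp).
  have [->|rp'] := eqVneq r p; last first.
    rewrite [X in _ + X](_ : _ = 0) ?addr0 ?addn0 ?(negbTE rp') ?addn0 //.
    rewrite ifF //; apply/negbTE/eqP => /(congr1 (logn r)).
    by rewrite pfactorK // lognX (logn_prime _ pp) (negbTE rp') muln0.
  rewrite addn1 eqn_exp2l ?prime_gt1 // eqSS ltnS.
  by case: ltngtP => _; rewrite ?addr0 ?add0r.
rewrite big_mkcond (eq_big_nat _ _ E) big_split /= -!big_mkcond /=.
rewrite -IH //; last by rewrite n0 (ltn_trans nm).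
rewrite big_nat1_eq mangoldt_pfactor // mE natrM lnM ?posrE ?ltr0n ?(ltnW p1) //.
rewrite ifT // expn_gt0 (ltnW p1) /=; apply: leq_ltn_trans mB.
rewrite mE expnS mulnC leq_mul2r; apply/orP; right.
by apply: dvdn_leq => //; exact: pfactor_dvdnn.
Qed.

(** Chebyshev's psi function. *)
Definition cpsi n : R := \sum_(1 <= q < n.+1) mangoldt q.

(** Legendre's formula in logarithmic form: [n %/ q] counts the multiples of [q] up to [n]. *)
Lemma ln_fact_sum n B : (n < B)%N ->
  ln (n`!)%:R = \sum_(1 <= q < B) mangoldt q * (n %/ q)%:R.
Proof.
elim: n => [_|n IH nB].
  by rewrite fact0 ln1 big1 // => q _; rewrite div0n mulr0.
rewrite factS natrM lnM ?posrE ?ltr0n ?fact_gt0 // IH ?(ltnW nB) //.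
rewrite (@ln_sum_mangoldt n.+1 B) ?nB // big_mkcond -big_split /=.
apply: eq_big_nat => q /andP[q0 _].
rewrite divnS // natrD mulrDr; congr (_ + _).
by case: ifP => _; rewrite ?mulr1 ?mulr0.
Qed.

(** The logarithm of the central binomial coefficient is the sum of [mangoldt q] with coefficients
    [2n %/ q - 2 (n %/ q)]. These are nonnegative, and at least 1 for [n < q <= 2n]; the binomial
    coefficient itself is at most [2 ^ (2n)]. *)
Lemma cpsi_double n : cpsi n.*2 <= cpsi n + n.*2%:R.
Proof.
have bin : ('C(n.*2, n))%:R <= (2 ^ n.*2)%:R :> R.
  rewrite ler_nat -[X in (_ <= X ^ _)%N]/(1 + 1)%N expnDn.
  rewrite (bigD1 (inord n)) //= inordK ?ltnS -?addnn ?leq_addr //.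
  by rewrite !exp1n !muln1 leq_addr.
have F := @bin_fact n.*2 n.
have {}F : ln ((n.*2)`!)%:R = ln ('C(n.*2, n))%:R + (ln (n`!)%:R + ln (n`!)%:R) :> R.
  rewrite -F -?addnn ?leq_addr // addnK !natrM.
  by rewrite !lnM ?posrE ?mulr_gt0 ?ltr0n ?fact_gt0 ?bin_gt0 ?leq_addr.
have lnb : ln ('C(n.*2, n))%:R <= n.*2%:R :> R.
  apply: (le_trans (y := ln (2 ^ n.*2)%:R)).
    by rewrite ler_ln ?posrE ?ltr0n ?expn_gt0 ?bin_gt0 // -addnn leq_addr.
  rewrite natrX lnXn // -[leLHS]mulr_natl ler_piMr //.
  by apply: le_ln1Dx; lra.
rewrite -lerBlDl; apply: le_trans lnb.
have -> : ln ('C(n.*2, n))%:R = ln ((n.*2)`!)%:R - (ln (n`!)%:R + ln (n`!)%:R) :> R.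
  by rewrite F addrK.
have nn : (n <= n.*2)%N by rewrite -addnn leq_addr.
rewrite !(@ln_fact_sum _ (n.*2).+1) ?ltnS // -big_split /= -sumrB.
rewrite /cpsi (@big_cat_nat _ _ _ n.+1 1 (n.*2).+1) //= addrAC subrr add0r.
rewrite [leRHS](@big_cat_nat _ _ _ n.+1 1 (n.*2).+1) //=.
rewrite -[leLHS]add0r lerD //.
  apply: sumr_ge0 => q _; rewrite -mulrDr -mulrBr mulr_ge0 ?mangoldt_ge0 //.
  rewrite subr_ge0 -natrD ler_nat addnn -!muln2; nia.
apply: ler_sum_nat => q /andP[nq qn].
rewrite (divn_small nq) !mulr0 addr0 subr0 ler_peMr ?mangoldt_ge0 // ler1n.
by rewrite divn_gt0 //; lia.
Qed.

(** Strong induction through [n./2]. For odd [n] the extra term [mangoldt n] is at most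
    [ln n <= n - 1], which the constant 4 absorbs. *)
Lemma cpsi_le n : cpsi n <= 4 * n%:R.
Proof.
elim/ltn_ind: n => n IH.
have [n2|n2] := ltnP n 2.
  rewrite /cpsi big_nat big1 ?mulr_ge0 // => q q2.
  have -> : q = 1%N by lia.
  by rewrite /mangoldt.
have h : (n./2 < n)%N by lia.
have nE := odd_double_half n.
have D : cpsi n./2.*2 <= 4 * n./2%:R + n./2.*2%:R.
  by apply: le_trans (cpsi_double _) _; rewrite lerD2r IH.
rewrite -muln2 natrM in D.
have [no|ne] := boolP (odd n); last first.
  rewrite -nE (negbTE ne) add0n -muln2 natrM.
  have := ler0n R n./2; lra.
have S : cpsi n <= cpsi n./2.*2 + ln n%:R.
  move: nE; rewrite no add1n; move: n./2 => j <-.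
  rewrite /cpsi [X in X <= _]big_nat_recr //= lerD2l.
  rewrite (@ln_sum_mangoldt (j.*2).+1 (j.*2).+2) ?ltnSn //.
  rewrite big_mkcond big_nat_recr //= dvdnn lerDr sumr_ge0 // => q _.
  by case: ifP => // _; exact: mangoldt_ge0.
have L : ln n%:R <= n%:R - 1 :> R.
  have := @le_ln1Dx R (n%:R - 1); rewrite [1 + _]addrC subrK; apply.
  have : (0 < n%:R :> R) by rewrite ltr0n; lia.
  by lra.
have : n%:R = 1 + 2 * n./2%:R :> R.
  by rewrite -{1}nE no -muln2 natrD natrM mulrC.
rewrite -muln2 in S.
have := ler0n R n./2; lra.
Qed.

(** The upper half of Mertens' estimate: compare [ln n! <= n ln n] with Legendre's formula, using
    [n / q <= 2 (n %/ q)] for [q <= n]. *)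
Lemma sum_mangoldt_div_le n : \sum_(1 <= q < n.+1) mangoldt q / q%:R <= 2 * ln n%:R.
Proof.
case: n => [|n]; first by rewrite big_geq // ln0 // mulr0.
have F : ln ((n.+1)`!)%:R <= n.+1%:R * ln n.+1%:R :> R.
  apply: (le_trans (y := ln (n.+1 ^ n.+1)%:R)).
    rewrite ler_ln ?posrE ?ltr0n ?expn_gt0 ?fact_gt0 // ler_nat.
    elim: n.+1 => // m IHm; rewrite factS expnS leq_mul2l /= (leq_trans IHm) //.
    by case: m {IHm} => // m; rewrite leq_exp2r.
  by rewrite natrX lnXn ?ltr0n // mulr_natl.
rewrite (@ln_fact_sum _ n.+2) // in F.
have n0 : 0 < n.+1%:R :> R by rewrite ltr0n.
rewrite -(ler_pM2l n0) mulr_sumr mulrCA.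
apply: (@le_trans _ _ (2 * \sum_(1 <= q < n.+2) mangoldt q * (n.+1 %/ q)%:R)); last first.
  by rewrite ler_pM2l.
rewrite mulr_sumr; apply: ler_sum_nat => q /andP[q0 qn].
rewrite mulrCA [leRHS]mulrCA ler_wpM2l ?mangoldt_ge0 //.
rewrite ler_pdivrMr ?ltr0n // -!natrM ler_nat.
have := divn_eq n.+1 q; have := ltn_mod n.+1 q; rewrite q0 => /idP.
have : (0 < n.+1 %/ q)%N by rewrite divn_gt0.
by nia.
Qed.
End Mangoldt.

(** * Dyadic cells of divisor tuples *)

Section SumCover.
Variable R : numDomainType.

(** The left indices all lie in the image of [phi], which need not be injective: further preimages
    only add nonnegative terms. Most changes of variables below are instances of this inequality. *)
Lemma sum_cover (I J : eqType) (r : seq I) (s : seq J) (P : pred I) (Q : pred J)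
    (phi : J -> I) (F : I -> R) :
  uniq r -> (forall i, 0 <= F i) ->
  (forall i, i \in r -> P i -> exists2 j, j \in s & Q j /\ phi j = i) ->
  \sum_(i <- r | P i) F i <= \sum_(j <- s | Q j) F (phi j).
Proof.
move=> ur F0 cov.
apply: (@le_trans _ _ (\sum_(i <- r | P i) \sum_(j <- s | Q j && (phi j == i)) F i)).
  rewrite big_seq_cond [leRHS]big_seq_cond; apply: ler_sum => i /andP[ir Pi].
  have [j js [Qj pj]] := cov i ir Pi.
  rewrite (big_rem j) //= Qj pj eqxx /= lerDl sumr_ge0 // => *; exact: F0.
rewrite (exchange_big_dep Q) /=; last by move=> i j _ /andP[].
apply: ler_sum => j Qj; rewrite Qj /=.
have [pr|pr] := boolP (phi j \in r); last first.
  rewrite big_seq_cond big1 // => i /and3P[ir _ /eqP E].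
  by rewrite E ir in pr.
rewrite -big_filter.
have Eq : forall i, i \in [seq x <- r | P x && (phi j == x)] -> i = phi j.
  by move=> i; rewrite mem_filter => /andP[/andP[_ /eqP]].
have : uniq [seq x <- r | P x && (phi j == x)] by rewrite filter_uniq.
case: [seq x <- r | P x && (phi j == x)] Eq => [|a [|b l]] Eq U.
- by rewrite big_nil F0.
- by rewrite big_seq1 (Eq a) // mem_head.
- move: U; rewrite /= (Eq a) ?mem_head // (Eq b) ?inE ?eqxx ?orbT //.
Qed.

Lemma sum_cover_prod (X : nat) (P : pred nat) (Q1 Q2 : pred nat)
    (phi : nat -> nat -> nat) (F : nat -> R) :
  (forall i, 0 <= F i) ->
  (forall m, (0 < m <= X)%N -> P m ->
     exists a b, [/\ (0 < a <= X)%N, (0 < b <= X)%N, Q1 a, Q2 b & phi a b = m]) ->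
  \sum_(1 <= m < X.+1 | P m) F m <=
  \sum_(1 <= a < X.+1 | Q1 a) \sum_(1 <= b < X.+1 | Q2 b) F (phi a b).
Proof.
move=> F0 cov.
set s := [seq (a, b) | a <- index_iota 1 X.+1, b <- index_iota 1 X.+1].
apply: (@le_trans _ _ (\sum_(t <- s | Q1 t.1 && Q2 t.2) F (phi t.1 t.2))).
  apply: (@sum_cover _ _ _ _ _ _ (fun t => phi t.1 t.2)) => //; first exact: iota_uniq.
  move=> m; rewrite mem_index_iota ltnS => /cov{}cov /cov[a [b [ha hb q1 q2 <-]]].
  exists (a, b); last by rewrite q1 q2.
  by apply/allpairsP; exists (a, b); rewrite !mem_index_iota !ltnS.
rewrite big_mkcond big_allpairs /=.
rewrite [leRHS]big_mkcond; apply: ler_sum => a _; case: (Q1 a) => /=.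
  by rewrite -big_mkcond.
by rewrite big1.
Qed.

Lemma sum_multiples (X Q : nat) (P : pred nat) (F : nat -> R) : (0 < Q)%N ->
  (forall i, 0 <= F i) ->
  \sum_(1 <= n < X.+1 | (Q %| n)%N && P n) F n <=
  \sum_(1 <= m < X.+1 | (m * Q <= X)%N && P (m * Q)%N) F (m * Q)%N.
Proof.
move=> Q0 F0; apply: (@sum_cover _ _ _ _ _ _ (fun m => m * Q)%N) => //.
  exact: iota_uniq.
move=> n; rewrite mem_index_iota => /andP[n0 nX] /andP[/dvdnP[m nE] Pn].
exists m; last by rewrite -nE Pn -ltnS nX.
by rewrite mem_index_iota; nia.
Qed.

End SumCover.

(** Induction on [s]: the first factor is split by its gcd [c] with [a]. The quotient [h] is coprime
    to [a / c], so it divides [r], and the remaining factors are split against [a / c] and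
    [r / h]. *)
Lemma dvdn_prod_split (I : eqType) (s : seq I) (g : I -> nat) (a r : nat) :
  (0 < a)%N -> (0 < r)%N -> uniq s -> (\prod_(i <- s) g i %| a * r)%N ->
  exists g' h : I -> nat, [/\ forall i, i \in s -> g i = (g' i * h i)%N,
    (\prod_(i <- s) g' i %| a)%N & (\prod_(i <- s) h i %| r)%N].
Proof.
elim: s a r => [|i0 s IH] a r a0 r0; first by exists g, g; rewrite !big_nil !dvd1n.
rewrite /= big_cons => /andP[i0s us] D.
set c := gcdn (g i0) a.
have c0 : (0 < c)%N by rewrite gcdn_gt0 a0 orbT.
have /dvdnP[a1 aE] : (c %| a)%N by exact: dvdn_gcdr.
have /dvdnP[h gE] : (c %| g i0)%N by exact: dvdn_gcdl.
have cop : coprime h a1.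
  move: (erefl c); rewrite {1}/c gE aE -muln_gcdl => /eqP.
  by rewrite -{2}(mul1n c) eqn_pmul2r.
have hr : (h %| r)%N.
  rewrite -(@Gauss_dvdr _ a1) // -(@dvdn_pmul2r c) // -gE mulnAC -aE.
  by apply: dvdn_trans D; exact: dvdn_mulr.
have /dvdnP[r1 rE] := hr.
have h0 : (0 < h)%N by move: r0; rewrite rE muln_gt0 => /andP[].
have [||//||g' [h' [E Pa Pr]]] := IH a1 r1.
- by move: a0; rewrite aE muln_gt0 => /andP[].
- by move: r0; rewrite rE muln_gt0 => /andP[].
- rewrite -(@dvdn_pmul2l (h * c)); last by rewrite muln_gt0 h0.
  by move: D; rewrite gE aE rE; congr (_ %| _)%N; ring.
exists (fun i => if i == i0 then c else g' i), (fun i => if i == i0 then h else h' i).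
have N i : i \in s -> (i == i0) = false.
  by move=> si; apply/negbTE; apply: contraNneq i0s => <-.
split.
- move=> i; rewrite inE; case: eqP => [-> _|_ /= /E//].
  by rewrite gE mulnC.
- rewrite big_cons eqxx aE mulnC dvdn_pmul2r // (eq_big_seq g') // => i /N -> //.
- rewrite big_cons eqxx rE mulnC dvdn_pmul2r // (eq_big_seq h') // => i /N -> //.
Qed.

Lemma trunc_log2M (a b : nat) : (0 < a)%N -> (0 < b)%N ->
  exists e : bool, trunc_log 2 (a * b) = (trunc_log 2 a + trunc_log 2 b + e)%N.
Proof.
move=> a0 b0.
have /andP[la ua] := @trunc_log_bounds 2 a isT a0.
have /andP[lb ub] := @trunc_log_bounds 2 b isT b0.
have L : (trunc_log 2 a + trunc_log 2 b <= trunc_log 2 (a * b))%N.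
  by apply: trunc_log_max => //; rewrite expnD leq_mul.
have U : (trunc_log 2 (a * b) < trunc_log 2 a + trunc_log 2 b + 2)%N.
  rewrite -(@ltn_exp2l 2) //; apply: leq_ltn_trans (_ : a * b < _)%N.
    by apply: trunc_logP => //; rewrite muln_gt0 a0.
  by rewrite addn2 -addSn -addnS expnD ltn_mul.
exists ((trunc_log 2 a + trunc_log 2 b) < trunc_log 2 (a * b))%N.
by case: ltnP => /=; lia.
Qed.

Lemma trunc_log2_leq n : (trunc_log 2 n <= n)%N.
Proof.
case: n => // n; apply: leq_trans (_ : 2 ^ trunc_log 2 n.+1 <= _)%N.
  by rewrite ltnW // ltn_expl.
exact: trunc_logP.
Qed.

(** * The truncated divisor function *)

Section Tau.
Variable X : nat.

(* Only divisors up to X are counted. *)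
Definition tau (r : nat) : nat := \sum_(1 <= d < X.+1) (d %| r).

Lemma natr_tau (R : numDomainType) r :
  (tau r)%:R = \sum_(1 <= d < X.+1 | (d %| r)%N) 1 :> R.
Proof. by rewrite natr_sum [RHS]big_mkcond; apply: eq_bigr => d _; case: (_ %| _)%N. Qed.

(** Every divisor of [m * n] is a divisor of [m] times a divisor of [n]. *)
Lemma leq_tauM m n : (0 < m)%N -> (0 < n)%N -> (tau (m * n) <= tau m * tau n)%N.
Proof.
move=> m0 n0; rewrite -(ler_nat int) natrM !natr_tau mulr_suml.
under [leRHS]eq_bigr do rewrite mul1r.
apply: (@sum_cover_prod _ _ _ _ _ muln) => // d /andP[d0 dX] dmn.
have [||//||g [h [E]]] := @dvdn_prod_split unit [:: tt] (fun=> d) m n => //.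
  by rewrite big_seq1.
rewrite !big_seq1 => gm hn; have {E}E := E tt (mem_head _ _).
by exists (g tt), (h tt); split => //; rewrite -?E //; move: d0 dX; rewrite E muln_gt0; nia.
Qed.

Lemma tau_prime p : prime p -> (tau p <= 2)%N.
Proof.
move=> pp; apply: (@leq_trans (\sum_(1 <= d < X.+1) ((d == 1%N) + (d == p)))).
  rewrite /tau; apply: leq_sum => d _; case: (boolP (d %| p)%N) => // dp.
  by have := primeP pp => -[_ /(_ _ dp)]; case: (_ == 1)%N => //= ->.
have C c : (\sum_(1 <= d < X.+1) (d == c) <= 1)%N.
  by rewrite -(@big_mkcond _ _ _ _ _ (fun d => d == c) (fun=> 1%N)) big_nat1_eq; case: ifP.
by rewrite big_split /=; apply: (leq_add (C 1%N) (C p)).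
Qed.
End Tau.

(** * Counting the occupied cells *)

Section Cells.
Variables (k X : nat) (S : 'I_k -> pred nat).
Implicit Types (m a b r : nat) (g j : {ffun 'I_k -> 'I_X.+1}).

(** [S i] holds the primes allowed in the i-th component; it is later taken to be the primes up to
    [2 y_i]. *)
Definition admissible m g : bool :=
  (\prod_i (g i : nat) %| m)%N && [forall i, all (S i) (primes (g i))].

(* A box of side log 2 is recorded by the dyadic positions of its corner, so that
   Ncells m is comparable to the measure of the union of boxes attached to m. *)
Definition cells m : {set {ffun 'I_k -> 'I_X.+1}} :=
  [set j : {ffun 'I_k -> 'I_X.+1} |
    [exists g, admissible m g && [forall i, trunc_log 2 (g i) == j i :> nat]]].

Definition Ncells m := #|cells m|.

Lemma admissible_gt0 m g i : (0 < m)%N -> admissible m g -> (0 < g i)%N.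
Proof.
move=> m0 /andP[Dg _]; apply: (dvdn_gt0 m0).
by apply: dvdn_trans Dg; rewrite (bigD1 i) //= dvdn_mulr.
Qed.

(** An admissible tuple for [a * r] splits as [g_i = g'_i h_i] with the product of the [g'_i]
    dividing [a] and every [h_i] dividing [r]. Its cell is determined by the cell of [g'], the tuple
    [h], and one carry bit per coordinate. *)
Lemma leq_NcellsM a r : (0 < a)%N -> (0 < r)%N ->
  (Ncells (a * r) <= (2 * tau X r) ^ k * Ncells a)%N.
Proof.
move=> a0 r0.
pose D := [set h : 'I_X.+1 | (0 < h)%N && (h %| r)%N].
have DE : #|D| = tau X r.
  rewrite -sum1_card /tau big_add1 /= big_mkord big_mkcond big_ord_recl /= inE /= add0n.
  by apply: eq_bigr => d _; rewrite inE /= /bump /= add1n; case: (_ %| _)%N.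
(* [Phi] rebuilds the cell of [g] from these data; [inord] is harmless because the sum is then the
   exponent of [g i], which is at most [X]. *)
pose Phi (t : {ffun 'I_k -> 'I_X.+1} * ({ffun 'I_k -> 'I_X.+1} * {ffun 'I_k -> bool})) :
  {ffun 'I_k -> 'I_X.+1} := [ffun i => inord (t.1 i + trunc_log 2 (t.2.1 i) + t.2.2 i)].
pose T := finset.setX (cells a) (finset.setX
  [set h : {ffun 'I_k -> 'I_X.+1} | h \in ffun_on D] [set: {ffun 'I_k -> bool}]).
have : (#|T| = (2 * tau X r) ^ k * Ncells a)%N.
  have Hc : #|[set h : {ffun 'I_k -> 'I_X.+1} | h \in ffun_on D]| = (tau X r ^ k)%N.
    by rewrite cardsE card_ffun_on card_ord DE.
  rewrite !cardsX Hc cardsT card_ffun card_bool card_ord -/(Ncells a).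
  by rewrite mulnC expnMn [(2 ^ k * _)%N]mulnC.
move=> <-; apply: leq_trans (leq_imset_card Phi T); apply: subset_leq_card.
apply/fintype.subsetP => j; rewrite inE => /existsP[g /andP[ag Lg]]; have /andP[Dg Sg] := ag.
have [||//||g' [h [E Pa Pr]]] := @dvdn_prod_split 'I_k (index_enum 'I_k) (fun i => g i) a r => //.
  exact: index_enum_uniq.
have {}E i : g i = (g' i * h i)%N :> nat by apply: E; rewrite mem_index_enum.
have g0 i : (0 < g i)%N by apply: admissible_gt0 ag; rewrite muln_gt0 a0.
have gh0 i : (0 < g' i)%N && (0 < h i)%N by rewrite -muln_gt0 -E.
have gX i : (g' i < X.+1)%N.
  apply: leq_ltn_trans (ltn_ord (g i)); rewrite E leq_pmulr //; by case/andP: (gh0 i).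
have hX i : (h i < X.+1)%N.
  apply: leq_ltn_trans (ltn_ord (g i)); rewrite E leq_pmull //; by case/andP: (gh0 i).
have tX i : (trunc_log 2 (g' i) < X.+1)%N.
  by rewrite (leq_ltn_trans _ (gX i)) // trunc_log2_leq.
have ex i : exists e : bool, trunc_log 2 (g i) = (trunc_log 2 (g' i) + trunc_log 2 (h i) + e)%N.
  by rewrite E; case/andP: (gh0 i) => *; apply: trunc_log2M.
have [e he] := choice ex.
apply/imsetP; exists ([ffun i => inord (trunc_log 2 (g' i))],
   ([ffun i => inord (h i)], [ffun i => e i])).
  rewrite !inE /= andbT; apply/andP; split.
    apply/existsP; exists [ffun i => inord (g' i)].
    apply/andP; split; last by apply/forallP => i; rewrite !ffunE !inordK.
    apply/andP; split.
      by rewrite (eq_bigr (fun i => g' i)) // => i _; rewrite ffunE inordK.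
    apply/forallP => i; rewrite ffunE inordK //.
    apply/allP => p; rewrite mem_primes => /and3P[pp _ pg].
    have /allP := forallP Sg i; apply; rewrite mem_primes pp g0 E.
    exact: dvdn_mulr.
  apply/ffun_onP => i; rewrite inE ffunE inordK //; case/andP: (gh0 i) => _ -> /=.
  by apply: dvdn_trans Pr; rewrite (bigD1 i) //= dvdn_mulr.
apply/ffunP => i; apply: val_inj; rewrite /= !ffunE /= !inordK //.
- by rewrite -he (eqP (forallP Lg i)).
- by rewrite -he (eqP (forallP Lg i)).
Qed.

Lemma leq_Ncells_prime a p : (0 < a)%N -> prime p -> (Ncells (a * p) <= 4 ^ k * Ncells a)%N.
Proof.
move=> a0 pp; apply: leq_trans (leq_NcellsM a0 (prime_gt0 pp)) _.
rewrite leq_mul2r; apply/orP; right; case: (k) => // k'.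
by rewrite leq_exp2r // (leq_mul (leqnn 2) (tau_prime X pp)).
Qed.

(** No component of an admissible tuple shares a prime with [b], so the product of the components
    already divides [a]. *)
Lemma leq_Ncells_coprime a b :
  (0 < a)%N -> (0 < b)%N -> (forall i p, prime p -> (p %| b)%N -> ~~ S i p) ->
  (Ncells (a * b) <= Ncells a)%N.
Proof.
move=> a0 b0 Sb; apply: subset_leq_card; apply/fintype.subsetP => j.
rewrite !inE => /existsP[g /andP[ag Lg]]; have /andP[Dg Sg] := ag.
have ab0 : (0 < a * b)%N by rewrite muln_gt0 a0.
apply/existsP; exists g; rewrite Lg andbT /admissible Sg andbT.
move: Dg; rewrite Gauss_dvdl //.
apply: (big_ind (fun x => coprime x b)) => [||i _]; first exact: coprime1n.
  by move=> x y cx cy; rewrite coprimeMl cx cy.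
have g0 : (0 < g i)%N by apply: admissible_gt0 ag.
rewrite coprime_has_primes //; apply/hasPn => p; rewrite mem_primes => /and3P[pp _ pb].
apply/negP => /(allP (forallP Sg i)); exact/negP/Sb.
Qed.

Lemma Ncells_gt0 m : (0 < X)%N -> (0 < Ncells m)%N.
Proof.
move=> X0; rewrite card_gt0; apply/set0Pn; exists [ffun=> ord0]; rewrite inE.
apply/existsP; exists [ffun=> inord 1]; apply/andP; split; last first.
  by apply/forallP => i; rewrite !ffunE inordK.
apply/andP; split; first by rewrite big1 ?dvd1n // => i _; rewrite ffunE inordK.
by apply/forallP => i; rewrite ffunE inordK.
Qed.
End Cells.

(** * The iterated Lebesgue measure *)

Section IteratedMeasure.
Variable R : realType.
Local Notation mu := (@lebesgue_measure R).
Local Notation h := (ln 2 : R).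

(* The iterated integrals in lebk are monotone without any measurability
   assumption, because the integral of a nonnegative function is a supremum. *)
Lemma ge0_le_integralT (f g : R -> \bar R) :
  (forall x, 0 <= f x)%E -> (forall x, f x <= g x)%E ->
  (\int[mu]_x f x <= \int[mu]_x g x)%E.
Proof.
move=> f0 fg; have g0 x : (0 <= g x)%E by exact: le_trans (f0 x) (fg x).
rewrite !ge0_integralTE //; apply: le_ereal_sup => _ [s /= sf <-].
by exists s => //= x; exact: le_trans (sf x) (fg x).
Qed.

Lemma lebk_ge0 n (U : set (seq R)) : (0 <= lebk n U)%E.
Proof.
elim: n U => [|n IH] U /=; first by rewrite lee_fin ler0n.
by apply: integral_ge0 => t _; exact: IH.
Qed.

Lemma lebk_empty n (U : set (seq R)) : (forall s, ~ U s) -> lebk n U = 0%E.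
Proof.
elim: n U => [|n IH] U U0 /=; first by rewrite asboolF.
by apply: integral0_eq => t _; apply: IH => s; exact: U0.
Qed.

Lemma integral_itv_cst (a b c : R) : a <= b -> 0 <= c ->
  (\int[mu]_t (c%:E * (\1_(`[a, b[%classic) t)%:E) = (c * (b - a))%:E)%E.
Proof.
move=> ab c0; rewrite ge0_integralZl_EFin //.
  rewrite integral_indic // setIT [X in (_ * X)%E](_ : _ = (b - a)%:E) //.
  change (mu [set` `[a, b[] = (b - a)%:E).
  rewrite lebesgue_measure_itv /= lte_fin; move: ab; rewrite le_eqVlt.
  by case/orP => [/eqP ->|->]; rewrite ?ltxx ?subrr.
by apply/measurable_EFinP; exact: measurable_indic.
Qed.

(** Only finiteness is wanted here: [fine] in [Lk] would turn an infinite measure into 0. *)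
Lemma lebk_le n (U : set (seq R)) (M : R) : 0 <= M ->
  (forall s, U s -> forall i, (i < n)%N -> - M <= nth 0 s i < M) ->
  (lebk n U <= ((2 * M) ^+ n)%:E)%E.
Proof.
move=> M0; elim: n U => [|n IH] U HU /=.
  by rewrite expr0 lee_fin; case: asboolP.
apply: (@le_trans _ _ (\int[mu]_t (((2 * M) ^+ n)%:E * (\1_(`[- M, M[%classic) t)%:E))%E).
  apply: ge0_le_integralT => t; first exact: lebk_ge0.
  rewrite indicE; case: (boolP (t \in _)) => [tM|tM].
    rewrite mule1; apply: IH => s Us i ni.
    exact: (HU _ Us i.+1).
  rewrite mule0 lebk_empty // => s Us; move/negP: tM; apply; rewrite inE /= in_itv /=.
  exact: (HU _ Us 0%N).
rewrite integral_itv_cst ?exprn_ge0 ?mulr_ge0 //; last by lra.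
by rewrite exprSr lee_fin; have -> : M - - M = 2 * M by ring.
Qed.

Lemma ln2_gt0 : 0 < h. Proof. by apply: ln_gt0; lra. Qed.

(** [J] lists distinct dyadic cells, each containing the upper corner [T] of a box of side [ln 2]
    inside [U]. Once the first coordinate is fixed, the boxes meeting that slice have at most two
    possible first indices, so at least half as many distinct tails survive. Each dimension thus
    costs a factor 2, with no need to count overlaps globally. *)
Lemma lebk_ge n (U : set (seq R)) (J : seq (seq nat)) :
  uniq J -> (forall j, j \in J -> size j = n) ->
  (forall j, j \in J -> exists T : seq R,
     (forall i, (i < n)%N -> (nth 0%N j i)%:R * h <= nth 0 T i < (nth 0%N j i).+1%:R * h) /\
     (forall s, size s = n -> (forall i, (i < n)%N -> nth 0 T i - h <= nth 0 s i < nth 0 T i) ->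
        U s)) ->
  (((size J)%:R * (h / 2) ^+ n)%:E <= lebk n U)%E.
Proof.
have h0 := ln2_gt0.
elim: n U J => [|n IH] U J uJ sJ HJ.
  rewrite expr0 mulr1 /= lee_fin ler_nat.
  case: J uJ sJ HJ => [//|j [|j' J]] uJ sJ HJ.
    have [T [_ /(_ [::] erefl) UT]] := HJ j (mem_head _ _).
    by rewrite asboolT //; exact: UT.
  have /size0nil j'0 : size j' = 0%N by apply: sJ; rewrite in_cons mem_head orbT.
  by move: uJ; rewrite (size0nil (sJ j (mem_head _ _))) j'0 cons_uniq mem_head.
have /choice[T HT] : forall j, exists T : seq R, j \in J ->
     (forall i, (i < n.+1)%N -> (nth 0%N j i)%:R * h <= nth 0 T i < (nth 0%N j i).+1%:R * h) /\
     (forall s, size s = n.+1 ->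
        (forall i, (i < n.+1)%N -> nth 0 T i - h <= nth 0 s i < nth 0 T i) -> U s).
  move=> j; have [jJ|jJ] := boolP (j \in J); last by exists [::].
  by have [T HT] := HJ j jJ; exists T.
(* Half of the constant in dimension [n]; integrating [c] over a side of length [ln 2] gives the
   constant in dimension [n.+1]. *)
pose c : R := (h / 2) ^+ n / 2.
have c0 : 0 <= c by rewrite /c divr_ge0 // exprn_ge0 // divr_ge0 // ltW.
pose I j := `[nth 0 (T j) 0 - h, nth 0 (T j) 0[%classic : set R.
apply: (@le_trans _ _ (\int[mu]_t \sum_(j <- J) (c%:E * (\1_(I j) t)%:E))%E).
  rewrite ge0_integral_sum //; last 2 first.
  - move=> j; apply: emeasurable_funM => //.
    by apply/measurable_EFinP; apply: measurable_indic; exact: measurable_itv.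
  - by move=> j t _; rewrite -EFinM lee_fin mulr_ge0.
  under eq_bigr => j _ do rewrite integral_itv_cst ?gerBl ?(ltW h0) //.
  under eq_bigr => j _ do rewrite subKr.
  rewrite sumEFin lee_fin big_const_seq count_predT iter_addr_0 -[leRHS]mulr_natl.
  by rewrite /c exprSr le_eqVlt; apply/orP; left; apply/eqP; ring.
rewrite /=; apply: ge0_le_integralT => t.
  by rewrite sume_ge0 // => j _; rewrite -EFinM lee_fin mulr_ge0.
pose Jt := [seq j <- J | t \in I j].
have inI j : j \in Jt -> [/\ j \in J, nth 0 (T j) 0 - h <= t & t < nth 0 (T j) 0].
  by rewrite mem_filter => /andP[/set_mem]; rewrite /I /= in_itv /= => /andP[? ?] ?.
pose K := undup (map behead Jt).
have sK : (size Jt <= size K * 2)%N.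
  (* The corner coordinate lies in [(t, t + h]], so the first index lies in
     [(t / h - 1, t / h + 1]], an interval whose integers are among [u] and [u.-1]. *)
  pose u := Num.truncn (t / h + 1).
  have -> : (size K * 2)%N = size [seq (x :: tl) | tl <- K, x <- [:: u; u.-1]].
    by rewrite size_allpairs.
  apply: uniq_leq_size; first exact: filter_uniq.
  move=> j jJt; have [jJ t1 t2] := inI j jJt.
  apply/allpairsP; exists (behead j, head 0%N j) => /=; split.
  - by rewrite mem_undup map_f.
  - have [/(_ 0%N isT) /andP[T1 T2] _] := HT j jJ.
    rewrite nth0 in T1 T2.
    have u1 : (head 0%N j)%:R <= t / h + 1.
      by rewrite -lerBlDr ler_pdivlMr // mulrBl mul1r; lra.
    have u2 : t / h + 1 < (head 0%N j).+2%:R.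
      by rewrite -ltrBrDr ltr_pdivrMr // -natr1 addrK; lra.
    have u0 : 0 <= t / h + 1 by rewrite (le_trans _ u1).
    have := truncn_itv u0; rewrite -/u => /andP[v1 v2].
    have : ((head 0%N j) < u.+1)%N by rewrite -(ltr_nat R); exact: le_lt_trans u1 v2.
    have : (u < (head 0%N j).+2)%N by rewrite -(ltr_nat R); exact: le_lt_trans v1 u2.
    rewrite !inE; lia.
  - by have := sJ j jJ; case: j {jJt jJ t1 t2}.
apply: (@le_trans _ _ ((size K)%:R * (h / 2) ^+ n)%:E).
  under eq_bigr => j _ do rewrite -EFinM.
  rewrite sumEFin lee_fin -mulr_sumr.
  have -> : \sum_(j <- J) \1_(I j) t = (size Jt)%:R :> R.
    rewrite /Jt size_filter -sum1_count natr_sum [RHS]big_mkcond /=.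
    by apply: eq_bigr => j _; rewrite indicE; case: (t \in I j).
  rewrite /c mulrC mulrA mulrAC ler_wpM2r ?exprn_ge0 ?divr_ge0 ?(ltW h0) //.
  by rewrite ler_pdivrMr // -natrM ler_nat.
apply: IH; first exact: undup_uniq.
  move=> j; rewrite mem_undup => /mapP[j' /inI[j'J _ _] ->].
  by rewrite size_behead (sJ j').
move=> j; rewrite mem_undup => /mapP[j' /inI[j'J t1 t2] ->].
have [HT1 HT2] := HT j' j'J.
exists (behead (T j')); split=> [i ni|s sn Hs].
  by have := HT1 i.+1 ni; rewrite !nth_behead.
apply: HT2; first by rewrite /= sn.
case=> [_|i ni] /=; first by rewrite t1 t2.
by have := Hs i ni; rewrite !nth_behead.
Qed.
End IteratedMeasure.

(** * Reduction to squarefree integers with controlled primes *)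

Section TauSum.
Variables (R : realType) (X : nat).

Lemma sum_inv_sqr_le : \sum_(1 <= v < X.+1) (v%:R ^- 2 : R) <= 2.
Proof.
(* The sharper bound [2 - 1/X] telescopes; for [X = 0] the inverse is 0 by convention. *)
apply: (@le_trans _ _ (2 - X%:R^-1)); last by rewrite gerBl invr_ge0.
elim: X => [|[|n] IH]; first by rewrite big_geq // invr0; lra.
  by rewrite big_nat1 expr1n invr1; lra.
rewrite big_nat_recr //=; apply: le_trans (lerD IH (lexx _)) _.
have a0 : 0 < n.+1%:R :> R by rewrite ltr0n.
rewrite -[n.+2%:R]natr1; set a : R := n.+1%:R in a0 *.
rewrite -addrA lerD2l -subr_ge0.
have -> : - (a + 1)^-1 - (- a^-1 + (a + 1) ^- 2) = (a * (a + 1) ^+ 2)^-1 by field; lra.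
by rewrite invr_ge0 mulr_ge0 ?exprn_ge0 ?ltW ?addr_gt0.
Qed.

(** Induction on [j]: write one factor [tau v] as a sum over [d] dividing [v], put [v = m d], and
    use submultiplicativity. The sum is bounded by the square of the previous one, whence the
    exponent [2 ^ j]. *)
Lemma sum_tau_le j :
  \sum_(1 <= v < X.+1) ((tau X v)%:R ^+ j / v%:R ^+ 2 : R) <= 2 ^+ (2 ^ j).
Proof.
elim: j => [|j IH].
  by under eq_bigr do rewrite expr0 mul1r; exact: sum_inv_sqr_le.
rewrite expnS mul2n -addnn exprD.
apply: (@le_trans _ _ (\sum_(1 <= d < X.+1) \sum_(1 <= m < X.+1)
   ((tau X m)%:R ^+ j / m%:R ^+ 2) * ((tau X d)%:R ^+ j / d%:R ^+ 2))); last first.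
  under eq_bigr do rewrite -mulr_suml.
  rewrite -mulr_sumr; apply: ler_pM => //.
  - by apply: sumr_ge0 => v _; rewrite divr_ge0 // exprn_ge0.
  - by apply: sumr_ge0 => v _; rewrite divr_ge0 // exprn_ge0.
have -> : \sum_(1 <= v < X.+1) ((tau X v)%:R ^+ j.+1 / v%:R ^+ 2 : R) =
   \sum_(1 <= d < X.+1) \sum_(1 <= v < X.+1 | (d %| v)%N && true) ((tau X v)%:R ^+ j / v%:R ^+ 2).
  under [RHS]eq_bigr do rewrite big_mkcond.
  rewrite exchange_big; apply: eq_bigr => v _; rewrite -big_mkcond /=.
  under eq_bigl do rewrite andbT.
  by rewrite exprS -mulrA {1}natr_tau mulr_suml; apply: eq_bigr => d _; rewrite mul1r.
rewrite big_nat [leRHS]big_nat; apply: ler_sum => d /andP[d0 _].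
apply: le_trans (sum_multiples _ _ d0 _) _.
  by move=> i; rewrite divr_ge0 // exprn_ge0.
rewrite big_mkcond !big_nat; apply: ler_sum => m /andP[m0 _].
case: ifP => _; last by rewrite mulr_ge0 // divr_ge0 // exprn_ge0.
rewrite natrM exprMn invfM [leRHS]mulrACA.
rewrite ler_wpM2r ?mulr_ge0 ?invr_ge0 ?exprn_ge0 //.
rewrite -exprMn -natrM lerXn2r ?nnegrE //.
by rewrite ler_nat leq_tauM.
Qed.
End TauSum.

Lemma square_part m : (0 < m)%N -> exists u v, [/\ squarefree u, (0 < v)%N & (u * v ^ 2)%N = m].
Proof.
elim/ltn_ind: m => m IH m0.
have [sf|] := pselect (squarefree m); first by exists m, 1%N; rewrite muln1.
move=> nsf; have [p pp /dvdnP[q mE]] : exists2 p, prime p & (p * p %| m)%N.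
  apply: contrapT => H; apply: nsf; split => // p pp pm; apply: H; by exists p.
have p1 := prime_gt1 pp.
have q0 : (0 < q)%N by move: m0; rewrite mE; case: (q).
have [|//|u [v [su v0 E]]] := IH q; first by rewrite mE ltn_Pmulr // (ltn_mul p1 p1).
exists u, (v * p)%N; split => //; first by rewrite muln_gt0 v0 ltnW.
by rewrite mE -E expnMn mulnA mulnn.
Qed.

Lemma squarefree_dvd a b : (a %| b)%N -> squarefree b -> squarefree a.
Proof.
move=> ab [b0 sb]; split=> [|p pp pa]; first exact: dvdn_gt0 ab.
by apply: (sb p pp); apply: dvdn_trans ab.
Qed.

(** * Weighted sums of cell counts *)

Section Reductions.
Variables (R : realType) (k X : nat) (S : 'I_k -> pred nat).

Definition wt (m : nat) : R := (Ncells X S m)%:R / m%:R.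

Lemma wt_ge0 m : 0 <= wt m.
Proof. by rewrite divr_ge0. Qed.

(** Write [m = u v^2] with [u] squarefree. The factor [v^2] multiplies the cell count by at most
    [(2 tau(v)^2) ^ k], and the sum of [tau(v) ^ (2k) / v^2] is bounded. *)
Lemma sum_wt_squarefree :
  \sum_(1 <= m < X.+1) wt m <=
  2 ^+ k * 2 ^+ (2 ^ (2 * k)) * \sum_(1 <= u < X.+1 | `[< squarefree u >]) wt u.
Proof.
pose phi u v := (u * v ^ 2)%N.
apply: le_trans (@sum_cover_prod R X xpredT (fun u => `[< squarefree u >]) xpredT
  phi wt wt_ge0 _) _.
  move=> m /andP[m0 mX] _; have [u [v [su v0 E]]] := square_part m0.
  exists u, v; split => //; last exact/asboolP.
    by case: su => u0 _; rewrite u0 /= (leq_trans _ mX) // -E leq_pmulr // expn_gt0 v0.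
  rewrite v0 /= (leq_trans _ mX) // -E; case: su => u0 _; nia.
rewrite mulr_sumr; apply: ler_sum => u /asboolP[u0 _].
apply: (@le_trans _ _ (\sum_(1 <= v < X.+1) (2 ^+ k * wt u) * ((tau X v)%:R ^+ (2 * k) / v%:R ^+ 2))).
  rewrite !big_nat; apply: ler_sum => v /andP[v0 _].
  rewrite /wt /phi natrM invfM natrX mulrA [leRHS]mulrA ler_wpM2r ?invr_ge0 ?exprn_ge0 //.
  rewrite mulrA [leRHS]mulrAC ler_wpM2r ?invr_ge0 //.
  rewrite mulrAC -!natrX -!natrM ler_nat.
  apply: leq_trans (leq_NcellsM _ _ u0 _) _; first by rewrite expn_gt0 v0.
  rewrite leq_mul2r expnMn expnM leq_mul2l; apply/orP; right; apply/orP; right.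
  case: (k) => // k'; rewrite leq_exp2r // -!mulnn; exact: leq_tauM.
rewrite -mulr_sumr [leRHS]mulrAC ler_wpM2l ?mulr_ge0 ?wt_ge0 ?exprn_ge0 //.
exact: sum_tau_le.
Qed.

Lemma wt_prime m p : (0 < m)%N -> prime p -> wt (m * p) <= 4 ^+ k / p%:R * wt m.
Proof.
move=> m0 pp; rewrite /wt natrM invfM [X in _ * X]mulrC [leRHS]mulrACA.
rewrite ler_wpM2r ?mulr_ge0 ?invr_ge0 //.
by rewrite -natrX -natrM ler_nat leq_Ncells_prime.
Qed.

(** Primes are removed one at a time. A squarefree multiple of [p] is [m p] with [p] not dividing
    [m], so the factor lost is [1 + 4^k / p], at most [expR (4^k / p)]. *)
Lemma sum_wt_avoid (L : seq nat) : all prime L ->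
  \sum_(1 <= u < X.+1 | `[< squarefree u >]) wt u <=
  expR (4 ^+ k * \sum_(p <- L) p%:R^-1) *
  \sum_(1 <= u < X.+1 | `[< squarefree u >] && all (fun p => ~~ (p %| u)%N) L) wt u.
Proof.
elim: L => [_|p L IH /andP[pp pL]].
  by rewrite big_nil mulr0 expR0 mul1r; under [leRHS]eq_bigl do rewrite andbT.
apply: le_trans (IH pL) _; rewrite big_cons mulrDr addrC expRD -mulrA ler_wpM2l ?expR_ge0 //.
set T := (X in _ <= _ * X).
have T0 : 0 <= T by apply: sumr_ge0 => *; exact: wt_ge0.
apply: (@le_trans _ _ ((1 + 4 ^+ k * p%:R^-1) * T)); last first.
  by rewrite ler_wpM2r // expR_ge1Dx.
rewrite mulrDl mul1r (bigID (fun u => p %| u)%N) /= addrC lerD //.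
  rewrite /T le_eqVlt; apply/orP; left; apply/eqP; apply: eq_bigl => u.
  by rewrite andbAC andbA.
under eq_bigl do rewrite andbC.
apply: le_trans (sum_multiples _ _ (prime_gt0 pp) wt_ge0) _.
rewrite mulr_sumr big_mkcond [leRHS]big_mkcond !big_nat.
apply: ler_sum => m /andP[m0 _].
case: ifP => [/and3P[_ /asboolP sf aL]|_]; last first.
  by case: ifP => // _; rewrite mulr_ge0 ?wt_ge0 // mulr_ge0 ?invr_ge0 ?exprn_ge0.
rewrite ifT; first exact: wt_prime.
apply/and3P; split.
- by apply/asboolP; apply: squarefree_dvd sf; exact: dvdn_mulr.
- apply/negP => pm; case: sf => _ /(_ p pp); apply; exact: dvdn_mul.
- apply/allP => q qL; apply: contra (allP aL q qL) => qm; exact: dvdn_mulr.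
Qed.

(** Factor [u] into its [pi]-part and its [pi^']-part; the latter has no allowed prime and does not
    increase the cell count. *)
Lemma sum_wt_rough (pi : nat_pred) (P : pred nat) :
  (forall i p, S i p -> p \in pi) -> (forall a b, P (a * b)%N -> P a) ->
  \sum_(1 <= u < X.+1 | P u) wt u <=
  (\sum_(1 <= b < X.+1 | pi^'.-nat b) b%:R^-1) *
  \sum_(1 <= a < X.+1 | P a && pi.-nat a) wt a.
Proof.
move=> Spi Pd.
apply: le_trans (@sum_cover_prod R X P (fun a => P a && pi.-nat a)
   (fun b => pi^'.-nat b) muln wt wt_ge0 _) _.
  move=> u /andP[u0 uX] Pu; exists (u`_pi)%N, (u`_(pi^'))%N; split.
  - by rewrite part_gt0 (leq_trans _ uX) // dvdn_leq // dvdn_part.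
  - by rewrite part_gt0 (leq_trans _ uX) // dvdn_leq // dvdn_part.
  - by rewrite part_pnat andbT; apply: (Pd _ (u`_(pi^'))%N); rewrite partnC.
  - exact: part_pnat.
  - exact: partnC.
rewrite mulrC mulr_suml big_nat_cond [leRHS]big_nat_cond; apply: ler_sum => a /andP[/andP[a0 _] _].
rewrite mulr_sumr big_nat_cond [leRHS]big_nat_cond; apply: ler_sum => b /andP[/andP[b0 _] pb].
rewrite /wt natrM invfM mulrA ler_wpM2r ?invr_ge0 // ler_wpM2r ?invr_ge0 // ler_nat.
apply: leq_Ncells_coprime => // i p pp pb'; apply/negP => /Spi ppi.
have := pnatP _ b0 pb p pp pb'; by rewrite inE /= ppi.
Qed.

(** Every [a <= Z] is a [pi]-number, so [a] and [b] are recovered from [a * b] as its two parts: the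
    products are distinct integers up to [X * Z]. *)
Lemma sum_rough_le (pi : nat_pred) (Z : nat) :
  (forall p, (p <= Z)%N -> p \in pi) ->
  (\sum_(1 <= a < Z.+1) a%:R^-1) * (\sum_(1 <= b < X.+1 | pi^'.-nat b) b%:R^-1) <=
  \sum_(1 <= n < (X * Z).+1) n%:R^-1 :> R.
Proof.
move=> Zpi; rewrite mulr_suml; under eq_bigr do rewrite mulr_sumr big_mkcond /=.
pose G (t : nat * nat) : R := t.1%:R^-1 * t.2%:R^-1.
pose s := [seq (a, b) | a <- index_iota 1 Z.+1, b <- index_iota 1 X.+1].
rewrite -(@big_allpairs _ _ _ _ _ _ _ (fun t => if pi^'.-nat t.2 then G t else 0)) -/s -big_mkcond.
have -> : \sum_(1 <= n < (X * Z).+1) n%:R^-1 =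
  \sum_(1 <= n < (X * Z).+1) G (n`_pi, n`_(pi^'))%N.
  by apply: eq_big_nat => n /andP[n0 _]; rewrite /G /= -invfM -natrM partnC.
apply: (@sum_cover _ _ _ _ _ _ _ (fun n => (n`_pi, n`_(pi^'))%N)).
- by apply: allpairs_uniq; rewrite ?iota_uniq // => -[a b] [a' b'] _ _ [-> ->].
- by move=> t; rewrite mulr_ge0 ?invr_ge0.
move=> _ /allpairsP[[a b] [/= aZ bX ->]] /= pb.
move: aZ bX; rewrite !mem_index_iota !ltnS => /andP[a0 aZ] /andP[b0 bX].
have pa : pi.-nat a.
  by apply/pnatP => // p _ /(dvdn_leq a0) pa; apply: Zpi; exact: leq_trans aZ.
exists (a * b)%N.
  by rewrite mem_index_iota ltnS muln_gt0 a0 b0 mulnC leq_mul.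
split => //; rewrite !partnM // (part_pnat_id pa) (part_p'nat pb) muln1.
by rewrite (part_pnat_id pb) part_p'nat ?pnatNK ?mul1n.
Qed.

(** Markov's inequality: bound the indicator by [ln (a_pi) / c], expand the logarithm over the
    primes [p <= M] dividing [a], and exchange sums. Each [p] costs [4^k / p], and the sum of
    [ln p / p] is at most [2 ln M]. *)
Lemma sum_wt_large_part (pi : nat_pred) (P : pred nat) (M : nat) (c : R) :
  0 < c -> (forall a, P a -> squarefree a) -> (forall a b, P (a * b)%N -> P a) ->
  (forall p, p \in pi -> (p <= M)%N) ->
  \sum_(1 <= a < X.+1 | P a && (c < ln (a`_pi)%N%:R)) wt a <=
  4 ^+ k / c * (2 * ln M%:R) * \sum_(1 <= a < X.+1 | P a) wt a.
Proof.
move=> c0 Psf Pd piM; set T := (X in _ <= _ * X).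
have T0 : 0 <= T by apply: sumr_ge0 => *; exact: wt_ge0.
have W0 : 0 <= 4 ^+ k :> R by rewrite exprn_ge0.
pose L (q : nat) : R := mangoldt R q.
have L0 q : 0 <= L q by exact: mangoldt_ge0.
apply: (@le_trans _ _ (\sum_(1 <= q < X.+1 | prime q && (q <= M)%N)
    c^-1 * L q * \sum_(1 <= a < X.+1 | (q %| a)%N && P a) wt a)).
  under [leRHS]eq_bigr do rewrite mulr_sumr.
  rewrite (exchange_big_dep P) /=; last by move=> q a _ /andP[].
  rewrite big_mkcondr /= big_nat_cond [leRHS]big_nat_cond; apply: ler_sum => a /andP[/andP[a0 aX] Pa].
  case: ifP => [ca|_]; last by rewrite sumr_ge0 // => q _; rewrite !mulr_ge0 ?wt_ge0 ?invr_ge0 ?(ltW c0).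
  rewrite -mulr_suml ler_peMl ?wt_ge0 // -mulr_sumr mulrC ler_pdivlMr // mul1r.
  apply: (le_trans (ltW ca)).
  rewrite (@ln_sum_mangoldt R (a`_pi)%N X.+1); last first.
    by rewrite part_gt0 (leq_ltn_trans _ aX) // dvdn_leq // dvdn_part.
  rewrite big_mkcond [leRHS]big_mkcond; apply: ler_sum => q _.
  case: ifP => qa; last by case: ifP => // _; exact: L0.
  have [->|/mangoldt_neq0[p [e [pp qE]]]] := eqVneq (mangoldt R q) 0.
    by case: ifP => // _; exact: L0.
  have [a0' sa] := Psf a Pa.
  have qa' : (q %| a)%N by apply: dvdn_trans qa _; exact: dvdn_part.
  (* Squarefreeness leaves only primes among the prime powers dividing [a]. *)
  have e0 : e = 0%N.
    case: e qE => // e qE; case: (sa p pp); apply: dvdn_trans qa'.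
    by rewrite qE !expnS mulnA dvdn_mulr.
  rewrite {}e0 expn1 in qE; rewrite qE in qa qa' *.
  rewrite ifT // pp qa' Pa !andbT /=; apply: piM.
  by apply: (pnatP pi (part_gt0 pi a) (part_pnat pi a)).
apply: (@le_trans _ _ (\sum_(1 <= q < X.+1 | prime q && (q <= M)%N) (4 ^+ k / c * T) * (L q / q%:R))).
  apply: ler_sum => q /andP[pq _].
  have -> : 4 ^+ k / c * T * (L q / q%:R) = c^-1 * L q * (4 ^+ k / q%:R * T) by ring.
  rewrite ler_wpM2l ?mulr_ge0 ?invr_ge0 ?(ltW c0) //.
  apply: le_trans (sum_multiples _ _ (prime_gt0 pq) wt_ge0) _.
  rewrite mulr_sumr big_mkcond [leRHS]big_mkcond !big_nat; apply: ler_sum => m /andP[m0 _].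
  case: ifP => [/andP[_ Pm]|_]; last first.
    by case: ifP => // _; rewrite mulr_ge0 ?wt_ge0 // mulr_ge0 ?invr_ge0.
  by rewrite (Pd _ _ Pm) wt_prime.
rewrite -mulr_sumr mulrAC ler_wpM2r // ler_wpM2l ?divr_ge0 ?(ltW c0) //.
apply: le_trans (sum_mangoldt_div_le R M).
apply: (@sum_cover _ _ _ _ _ _ _ id); first exact: iota_uniq.
  by move=> q; rewrite divr_ge0.
move=> q; rewrite mem_index_iota => /andP[q0 _] /andP[_ qM]; exists q => //.
by rewrite mem_index_iota q0 ltnS.
Qed.
End Reductions.

(** * The first moment bound *)

Section FirstMoment.
Variables (R : realType) (k X : nat) (y : 'I_k -> R).
Local Notation L := (mangoldt R).
Local Notation vec := {ffun 'I_k -> 'I_X.+1}.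
Implicit Types (m n : nat).

Lemma mangoldt0 : L 0 = 0. Proof. by rewrite /mangoldt ltn0 andbF. Qed.

Lemma ln_sum_mangoldt_ord m : (0 < m <= X)%N ->
  ln m%:R = \sum_(q < X.+1 | (q %| m)%N) L q.
Proof.
move=> mX; rewrite (@ln_sum_mangoldt R m X.+1) ?ltnS //.
rewrite -(big_mkord (fun q => q %| m)%N) [RHS]big_ltn_cond //.
by rewrite mangoldt0 add0r if_same.
Qed.

Lemma sum_mangoldt_le (v : R) : 0 <= v ->
  \sum_(q < X.+1 | (q : nat)%:R <= v) L q <= 4 * v.
Proof.
move=> v0; rewrite -(big_mkord (fun q => q%:R <= v)).
apply: (@le_trans _ _ (cpsi R (Num.truncn v))); last first.
  apply: le_trans (cpsi_le R _) _; by rewrite ler_pM2l // truncn_le.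
apply: (@le_trans _ _ (\sum_(0 <= q < (Num.truncn v).+1) L q)); last first.
  by rewrite big_ltn // mangoldt0 add0r.
apply: (@sum_cover _ _ _ _ _ _ _ id); first exact: iota_uniq.
  by move=> q; exact: mangoldt_ge0.
move=> q _ qv; exists q => //; rewrite mem_index_iota ltnS.
by rewrite truncn_ge_nat.
Qed.

Lemma sum_mangoldt_dyadic_le (u : R) : 0 < u ->
  \sum_(q < X.+1 | u < (q : nat)%:R <= 4 * u) L q / (q : nat)%:R <= 16.
Proof.
move=> u0; apply: (@le_trans _ _ (u^-1 * \sum_(q < X.+1 | (q : nat)%:R <= 4 * u) L q)).
  rewrite mulr_sumr big_mkcondl /= [leLHS]big_mkcond [leRHS]big_mkcond /=.
  apply: ler_sum => q _; case: ifP => // _; case: ifP => [uq|_]; last first.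
    by rewrite mulr_ge0 ?mangoldt_ge0 // invr_ge0 ltW.
  rewrite mulrC ler_wpM2r ?mangoldt_ge0 // lef_pV2 ?posrE //; first exact: ltW.
  exact: lt_trans uq.
rewrite mulrC ler_pdivrMr //; apply: le_trans (sum_mangoldt_le _) _; first by rewrite mulr_ge0 // ltW.
by rewrite mulrA -natrM.
Qed.

(** What remains of the conditions on the [d_i] after writing [d_i = g_i q_i] and removing the [q_i]
    from [n]. *)
Definition localized m (q : vec) : bool :=
  [exists g : vec, (\prod_i (g i : nat) %| m)%N &&
    [forall i, (y i < (g i * q i)%N%:R) && ((g i * q i)%N%:R <= 2 * y i)]].

Definition smooth_for (i : 'I_k) : pred nat := fun p => p%:R <= 2 * y i.

Hypothesis y_gt1 : forall i, 1 < y i.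

(** If [g] lies in the cell [j], then [2^(j_i) <= g_i < 2^(j_i + 1)] confines [q_i] to an interval
    [(u, 4u]] depending only on [j]. Summing over the [q_i] for a fixed cell gives at most 16 per
    coordinate, by Chebyshev. *)
Lemma sum_localized_le m : (0 < m <= X)%N ->
  \sum_(q : vec | localized m q) \prod_i (L (q i) / (q i : nat)%:R) <=
  16 ^+ k * (Ncells X smooth_for m)%:R.
Proof.
move=> /andP[m0 mX].
have y0 i : 0 < y i by apply: lt_trans (y_gt1 i).
pose u (j : vec) i : R := y i / 2 ^+ (j i).+1.
have u0 j i : 0 < u j i by rewrite divr_gt0 // exprn_gt0.
pose near (j : vec) i (q : 'I_X.+1) := u j i < (q : nat)%:R <= 4 * u j i.
have pos (q : vec) : 0 <= \prod_i (L (q i) / (q i : nat)%:R).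
  by apply: prodr_ge0 => i _; rewrite divr_ge0 ?mangoldt_ge0.
apply: (@le_trans _ _ (\sum_(j in cells X smooth_for m) \sum_(q in family (near j))
    \prod_i (L (q i) / (q i : nat)%:R))).
  rewrite (exchange_big_dep xpredT) //= [leLHS]big_mkcond; apply: ler_sum => q _.
  case: ifP => [/existsP[g /andP[Dg /forallP yg]]|_]; last by rewrite sumr_ge0.
  have q0 i : (0 < q i)%N.
    by have /andP[+ _] := yg i; case: (nat_of_ord (q i)) => //; rewrite muln0 ltNge ltW.
  have g0 i : (0 < g i)%N.
    by have /andP[+ _] := yg i; case: (nat_of_ord (g i)) => //; rewrite mul0n ltNge ltW.
  have tX i : (trunc_log 2 (g i) < X.+1)%N.
    exact: leq_ltn_trans (trunc_log2_leq _) (ltn_ord _).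
  pose j : vec := [ffun i => inord (trunc_log 2 (g i))].
  have jE i : j i = trunc_log 2 (g i) :> nat by rewrite ffunE inordK.
  rewrite (bigD1 j) /=; first by rewrite lerDl sumr_ge0.
  apply/andP; split.
    rewrite inE; apply/existsP; exists g; apply/andP; split; last first.
      by apply/forallP => i; rewrite jE.
    rewrite /admissible Dg /=; apply/forallP => i; apply/allP => p.
    rewrite mem_primes => /and3P[_ _ pg]; rewrite /smooth_for.
    have /andP[_ gy] := yg i; apply: le_trans gy; rewrite ler_nat.
    by apply: leq_trans (dvdn_leq (g0 i) pg) _; rewrite leq_pmulr.
  apply/familyP => i; rewrite /near /u jE.
  have /andP[lg ug] := @trunc_log_bounds 2 (g i) isT (g0 i).
  have /andP[yl yu] := yg i; rewrite natrM in yl yu.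
  rewrite -(ler_nat R) natrX in lg; rewrite -(ltr_nat R) natrX in ug.
  set t := 2 ^+ trunc_log 2 (g i) in lg *.
  have t0 : 0 < t by rewrite exprn_gt0.
  rewrite exprS in ug; rewrite exprS -/t in ug *.
  rewrite unfold_in /=; apply/andP; split.
    rewrite ltr_pdivrMr ?mulr_gt0 //; apply: lt_trans yl _.
    by rewrite mulrC ltr_pM2l ?ltr0n.
  rewrite mulrA ler_pdivlMr ?mulr_gt0 //.
  have : t * (q i)%:R <= (g i)%:R * (q i)%:R by rewrite ler_wpM2r.
  by lra.
apply: (@le_trans _ _ (\sum_(j in cells X smooth_for m) (16 : R) ^+ k)); last first.
  by rewrite sumr_const -[leLHS]mulr_natr.
apply: ler_sum => j _.
rewrite -(bigA_distr_big_dep _ (fun i (q : 'I_X.+1) => L q / (q : nat)%:R)).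
rewrite -[k in leRHS](card_ord k) -prodr_const.
apply: ler_prod => i _; rewrite sum_mangoldt_dyadic_le // andbT.
by apply: sumr_ge0 => q _; rewrite divr_ge0 ?mangoldt_ge0.
Qed.

Definition factored (n : nat) (q0 : 'I_X.+1) (q : vec) : bool :=
  (q0 * \prod_i (q i : nat) %| n)%N && localized (n %/ (q0 * \prod_i (q i : nat)))%N q.

(** Expand every logarithm by [mangoldt], with [q0] dividing the cofactor and [q_i] dividing [d_i].
    The tuple [g_i = d_i / q_i] witnesses that each choice is [factored]. *)
Lemma ln_factors_le n (d : vec) : (0 < n <= X)%N -> (\prod_i (d i : nat) %| n)%N ->
  (forall i, y i < (d i : nat)%:R <= 2 * y i) ->
  ln (n %/ \prod_i (d i : nat))%N%:R * \prod_i ln (d i : nat)%:R <=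
  \sum_(q0 < X.+1) \sum_(q : vec | factored n q0 q) L q0 * \prod_i L (q i).
Proof.
move=> /andP[n0 nX] Dn yd; set D := (\prod_i _)%N in Dn *.
have D0 : (0 < D)%N by exact: dvdn_gt0 Dn.
have d0 i : (0 < d i)%N.
  by apply: (dvdn_gt0 D0); rewrite /D (bigD1 i) //= dvdn_mulr.
set f := (n %/ D)%N.
have nE : (f * D)%N = n by rewrite divnK.
have f0 : (0 < f)%N by move: n0; rewrite -nE muln_gt0 => /andP[].
rewrite (ln_sum_mangoldt_ord (m := f)); last first.
  by rewrite f0 (leq_trans _ nX) // -nE leq_pmulr.
have -> : \prod_i ln (d i : nat)%:R = \prod_i \sum_(q < X.+1 | (q %| d i)%N) L q.
  by apply: eq_bigr => i _; rewrite ln_sum_mangoldt_ord // d0 /= -ltnS ltn_ord.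
rewrite (bigA_distr_big_dep (fun i (q : 'I_X.+1) => q %| d i)%N (fun i q => L q)).
rewrite mulr_suml [leLHS]big_mkcond; apply: ler_sum => q0 _.
have pos (q : vec) : 0 <= L q0 * \prod_i L (q i).
  by rewrite mulr_ge0 ?mangoldt_ge0 // prodr_ge0 // => i _; rewrite mangoldt_ge0.
case: ifP => [q0f|_]; last by rewrite sumr_ge0.
rewrite mulr_sumr [leLHS]big_mkcond [leRHS]big_mkcond; apply: ler_sum => q _.
case: ifP => [/familyP qd|_]; last by case: ifP.
rewrite ifT //.
have {}qd i : (q i %| d i)%N by have := qd i.
have Q0 : (0 < q0 * \prod_i (q i : nat))%N.
  rewrite muln_gt0 (dvdn_gt0 f0 q0f) prodn_gt0 // => i; exact: dvdn_gt0 (qd i).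
have gX i : (d i %/ q i < X.+1)%N by rewrite (leq_ltn_trans (leq_div _ _)).
have DE : D = ((\prod_i (d i %/ q i)) * \prod_i (q i : nat))%N.
  by rewrite /D -big_split; apply: eq_bigr => i _; rewrite /= divnK.
apply/andP; split.
  rewrite -nE DE; apply: dvdn_mul => //; exact: dvdn_mull.
apply/existsP; exists [ffun i => inord (d i %/ q i)]; apply/andP; split; last first.
  by apply/forallP => i; rewrite ffunE inordK // divnK.
rewrite (eq_bigr (fun i => d i %/ q i)%N); last by move=> i _; rewrite ffunE inordK.
rewrite dvdn_divRL; last first.
  rewrite -nE DE; apply: dvdn_mul => //; exact: dvdn_mull.
by rewrite mulnCA -DE -nE dvdn_mul.
Qed.

(** Substitute [n = m q0 Q] with [Q] the product of the [q_i]. For fixed [m] and [q], Chebyshev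
    bounds the sum over [q0] by [4 X / (m Q)], which supplies the weights [1 / q_i] needed for the
    localized sum. *)
Lemma sum_factored_le :
  \sum_(1 <= n < X.+1) \sum_(q0 < X.+1) \sum_(q : vec | factored n q0 q) L q0 * \prod_i L (q i) <=
  4 * 16 ^+ k * X%:R * \sum_(1 <= m < X.+1) wt R X smooth_for m.
Proof.
have LP0 (q : vec) : 0 <= \prod_i L (q i).
  by apply: prodr_ge0 => i _; rewrite mangoldt_ge0.
(* The index ranges contain 0; tuples with a zero entry contribute nothing. *)
have zero (q : vec) : (\prod_i (q i : nat) = 0)%N -> \prod_i L (q i) = 0.
  move=> Q0; have [/existsP[i /eqP qi]|/existsPn H] := boolP [exists i, q i == 0 :> nat]%N.
    by rewrite (bigD1 i) //= qi mangoldt0 mul0r.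
  have : (0 < \prod_i (q i : nat))%N by apply: prodn_gt0 => i; rewrite lt0n H.
  by rewrite Q0.
apply: (@le_trans _ _ (\sum_(1 <= m < X.+1) \sum_(q : vec | localized m q)
   (\prod_i L (q i)) * \sum_(q0 < X.+1 | (m * (q0 * \prod_i (q i : nat)) <= X)%N) L q0)).
  rewrite exchange_big /=.
  under eq_bigr => q0 _.
    under eq_bigr do rewrite big_mkcond /=.
    rewrite exchange_big /=.
    over.
  under [leRHS]eq_bigr => m _.
    under eq_bigr do rewrite mulr_sumr big_mkcond /=.
    rewrite exchange_big /=.
    over.
  rewrite [leRHS]exchange_big /=; apply: ler_sum => q0 _.
  under [leRHS]eq_bigr do rewrite big_mkcond /=.
  rewrite [leRHS]exchange_big /=; apply: ler_sum => q _.
  set Q := (q0 * \prod_i (q i : nat))%N; rewrite -big_mkcond /=.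
  have [Q0|Q0] := posnP Q.
    rewrite [leLHS]big1 => [|n _].
      apply: sumr_ge0 => m _; do 2!case: ifP => // _.
      by rewrite mulr_ge0 ?mangoldt_ge0.
    move/eqP: Q0; rewrite muln_eq0 => /orP[/eqP ->|]; first by rewrite mangoldt0 mul0r.
    by move=> /eqP /zero ->; rewrite mulr0.
  apply: le_trans (sum_multiples (F := fun=> L q0 * \prod_i L (q i)) _ _ Q0 _) _.
    by move=> _; rewrite mulr_ge0 ?mangoldt_ge0.
  rewrite big_mkcond /=; apply: ler_sum => m _; rewrite mulnK //.
  case: (m * Q <= X)%N; case: (localized m q) => //=.
  by rewrite mulrC.
rewrite mulr_sumr !big_nat; apply: ler_sum => m /andP[m0 mX].
apply: (@le_trans _ _ (\sum_(q : vec | localized m q) (4 * X%:R / m%:R) *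
   \prod_i (L (q i) / (q i : nat)%:R))).
  apply: ler_sum => q _.
  rewrite big_split /= prodfV -natr_prod.
  have [Q0|Q0] := posnP (\prod_i (q i : nat))%N; first by rewrite zero // !mul0r mulr0.
  rewrite mulrCA ler_wpM2l //; set Q := (\prod_i _)%N in Q0 *.
  have v0 : 0 < m%:R * Q%:R :> R by rewrite mulr_gt0 ?ltr0n.
  have -> : 4 * X%:R / m%:R / Q%:R = 4 * (X%:R / (m%:R * Q%:R)) :> R by rewrite invfM; ring.
  apply: le_trans (sum_mangoldt_le _); last first.
    by rewrite divr_ge0 // ltW.
  rewrite le_eqVlt; apply/orP; left; apply/eqP; apply: eq_bigl => q0.
  by rewrite ler_pdivlMr // -!natrM ler_nat mulnCA.
rewrite -mulr_sumr.
apply: le_trans (ler_wpM2l _ (sum_localized_le _)) _.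
- by rewrite divr_ge0 // mulr_ge0.
- by rewrite m0 -ltnS.
rewrite /wt le_eqVlt; apply/orP; left; apply/eqP; ring.
Qed.
End FirstMoment.

(** * Harmonic sums and a lower bound for Lk *)

Section Harmonic.
Variable R : realType.

Lemma sum_inv_le n : (0 < n)%N -> \sum_(1 <= i < n.+1) (i%:R^-1 : R) <= 1 + ln n%:R.
Proof.
case: n => // n _; elim: n => [|n IH]; first by rewrite big_nat1 invr1 ln1 addr0.
rewrite big_nat_recr //=; apply: le_trans (lerD IH (lexx _)) _.
rewrite -addrA lerD2l.
have a0 : 0 < n.+1%:R :> R by rewrite ltr0n.
have b0 : 0 < n.+2%:R :> R by rewrite ltr0n.
have := @le_ln1Dx R (- n.+2%:R^-1); rewrite ltrN2 invf_lt1 // ltr1n => /(_ isT).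
have -> : 1 - n.+2%:R^-1 = n.+1%:R / n.+2%:R :> R by rewrite -[n.+2%:R]natr1; field; lra.
rewrite ln_div ?posrE // ; move: (ln n.+1%:R) (ln n.+2%:R) (n.+2%:R^-1) => u v w H; lra.
Qed.

Lemma ln_le_sum_inv n : ln n.+1%:R <= \sum_(1 <= i < n.+1) (i%:R^-1 : R).
Proof.
elim: n => [|n IH]; first by rewrite big_geq // ln1.
rewrite big_nat_recr //=; apply: le_trans (lerD IH (lexx _)).
have a0 : 0 < n.+1%:R :> R by rewrite ltr0n.
have b0 : 0 < n.+2%:R :> R by rewrite ltr0n.
have := @le_ln1Dx R n.+1%:R^-1; have i0 : 0 < n.+1%:R^-1 :> R by rewrite invr_gt0.
have -> : 1 + n.+1%:R^-1 = n.+2%:R / n.+1%:R :> R by rewrite -[n.+2%:R]natr1; field; lra.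
rewrite ln_div ?posrE // => H; have := H (lt_trans (ltrN10 _) i0).
by move: (ln n.+1%:R) (ln n.+2%:R) (n.+1%:R^-1) => u v w {}H; lra.
Qed.

Lemma sum_le_real X (z : R) : 0 <= z -> \sum_(1 <= n < X.+1 | n%:R <= z) (1 : R) <= z.
Proof.
move=> z0; apply: (@le_trans _ _ (\sum_(1 <= n < (Num.truncn z).+1) (1 : R))).
  apply: (@sum_cover _ _ _ _ _ _ _ id) => //; first exact: iota_uniq.
  move=> n; rewrite mem_index_iota => /andP[n0 _] nz; exists n => //.
  by rewrite mem_index_iota n0 ltnS truncn_ge_nat.
by rewrite sumr_const_nat subSS subn0 truncn_le.
Qed.

Lemma sum_inv_dyadic_le X (u : R) : 0 < u ->
  \sum_(1 <= n < X.+1 | u < n%:R <= 2 * u) (n%:R^-1 : R) <= 2.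
Proof.
move=> u0; apply: (@le_trans _ _ (u^-1 * \sum_(1 <= n < X.+1 | n%:R <= 2 * u) (1 : R))).
  rewrite mulr_sumr [leLHS]big_mkcond [leRHS]big_mkcond /=.
  apply: ler_sum => n _; case: (n%:R <= _); rewrite ?andbF ?andbT //.
  case: ifP => un; rewrite mulr1; last by rewrite invr_ge0 ltW.
  by rewrite lef_pV2 ?posrE // ?ltW // (lt_trans u0).
rewrite mulrC ler_pdivrMr //; apply: sum_le_real; by rewrite mulr_ge0 // ltW.
Qed.
End Harmonic.

Section MeasureLower.
Variables (R : realType) (k X : nat).

(** Each cell in [J] has a representative [g] whose box with upper corner [(ln g_i)] is one of the
    boxes forming [Lset], so the lower bound for separated corners applies. *)
Lemma Lk_ge_card (a : nat -> nat) (J : {set {ffun 'I_k -> 'I_X.+1}}) :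
  (forall i, (1 <= i <= k)%N -> (0 < a i)%N) ->
  (forall j, j \in J -> exists2 g : nat -> nat, (forall i, (0 < g i)%N) &
     forall i : 'I_k, trunc_log 2 (g i) = j i /\
       (\prod_(0 <= l < i.+1) g l %| \prod_(1 <= l < i.+2) a l)%N) ->
  #|J|%:R * (ln 2 / 2) ^+ k <= Lk R k a.
Proof.
move=> a0 HJ.
pose A := (\prod_(1 <= l < k.+1) a l)%N.
have A0 : (0 < A)%N.
  by rewrite /A big_nat; apply: prodn_cond_gt0 => i; rewrite ltnS; exact: a0.
have l2 := @ln2_gt0 R.
have up : (lebk k (Lset k a) <= ((2 * (ln 2 + ln A%:R : R)) ^+ k)%:E)%E.
  apply: lebk_le => [|s [sk [d [Hd Hs]]] i ik].
    by rewrite addr_ge0 ?ln_nat_ge0 // ltW.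
  have [d0 Dd] := Hd i.+1 ik; have [s1 s2] := Hs i ik.
  have dA : (d i.+1 <= A)%N.
    apply: dvdn_leq => //; apply: dvdn_trans (dvdn_trans Dd _).
      by rewrite big_nat_recr //= dvdn_mull.
    by rewrite /A (@big_cat_nat _ _ _ i.+2 1 k.+1) //= dvdn_mulr.
  have lA : ln (d i.+1)%:R <= ln A%:R :> R.
    by rewrite ler_ln ?posrE ?ltr0n // ler_nat.
  rewrite ln_div ?posrE ?ltr0n // in s1.
  have := @ln_nat_ge0 R (d i.+1); have := @ln_nat_ge0 R A.
  by move=> h1 h2; apply/andP; split; lra.
pose sq (j : {ffun 'I_k -> 'I_X.+1}) := [seq (j i : nat) | i <- enum 'I_k].
have sqE j (i : 'I_k) : nth 0%N (sq j) i = j i.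
  by rewrite (nth_map i) ?size_enum_ord // nth_ord_enum.
have lo : ((#|J|%:R * (ln 2 / 2) ^+ k)%:E <= lebk k (Lset (R := R) k a))%E.
  have -> : #|J| = size [seq sq j | j <- enum J] by rewrite size_map -cardE.
  apply: (@lebk_ge R k (Lset k a) [seq sq j | j <- enum J]).
  - rewrite map_inj_uniq ?enum_uniq // => j j' E; apply/ffunP => i; apply: val_inj.
    by rewrite /= -!sqE E.
  - by move=> _ /mapP[j _ ->]; rewrite size_map size_enum_ord.
  move=> t /mapP[j + ->] {t}; rewrite mem_enum => jJ.
  have [g g0 Hg] := HJ j jJ.
  exists [seq ln (g i)%:R | i <- iota 0 k]; split=> [i ik|s sk Hs].
    rewrite (nth_map 0%N) ?size_iota // nth_iota // add0n.
    have [E _] := Hg (Ordinal ik).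
    have -> : nth 0%N (sq j) i = trunc_log 2 (g i) by rewrite E -sqE.
    have /andP[lg ug] := @trunc_log_bounds 2 (g i) isT (g0 i).
    rewrite !mulr_natl -!lnXn // -!natrX.
    by rewrite ler_ln ?ltr_ln ?posrE ?ltr0n ?expn_gt0 // ler_nat ltr_nat lg.
  (* The coordinates of [g] start at 0, the divisors [d] at 1. *)
  split => //; exists (fun i => g i.-1); split.
    case=> [//|i] ik; split; first exact: g0.
    have [_ H] := Hg (Ordinal ik); rewrite big_add1; exact: H.
  move=> i ik; have := Hs i ik; rewrite (nth_map 0%N) ?size_iota // nth_iota // add0n /=.
  by rewrite ln_div ?posrE ?ltr0n // => /andP[].
rewrite -lee_fin /Lk fineK // ge0_fin_numE ?lebk_ge0 //.
exact: le_lt_trans up (ltry _).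
Qed.
End MeasureLower.

(** * From integers to the vectors of the sum Lsum *)

Section Link.
Variables (R : realType) (k : nat) (y : nat -> R) (X : nat).
Hypothesis y_incr : forall i, (1 <= i < k)%N -> y i <= y i.+1.

Local Notation Y := (fun i : 'I_k => y i.+1).
Local Notation S := (smooth_for Y).

Lemma y_mono i j : (1 <= i)%N -> (i <= j)%N -> (j <= k)%N -> y i <= y j.
Proof.
move=> i1 /subnK <-; elim: (j - i)%N => // n IH nk.
by apply: le_trans (IH _) (y_incr _); rewrite ?(leq_trans _ nk) //; lia.
Qed.

Hypothesis k_gt0 : (0 < k)%N.
Hypothesis y1 : 1 < y 1%N.

Lemma y_gt1 i : (1 <= i <= k)%N -> 1 < y i.
Proof. by case/andP => i1 ik; apply: lt_le_trans y1 (y_mono _ _ _). Qed.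

(** Primes that may occur in a divisor [d_i <= 2 y_i] although they exceed [y_i]. Without them, a
    prime factor at most [2 y_i] is at most [y_i]. *)
Definition edge_prime p : bool :=
  [exists i : 'I_k, (y i.+1 < p%:R) && (p%:R <= 2 * y i.+1)].

Definition edge_primes : seq nat :=
  [seq p <- index_iota 1 X.+1 | prime p && edge_prime p].

Definition top_primes : nat_pred := [pred p | p%:R <= 2 * y k].
Definition layer i : nat_pred := [pred p | (tprev y i < p%:R) && (p%:R <= y i)].
Definition below i : nat_pred := [pred p | p%:R <= y i].

(** The integers left after the three reductions; up to [X], their parts along the layers form a
    vector of the target sum. *)
Definition core a : bool :=
  (`[< squarefree a >] && all (fun p => ~~ (p %| a)%N) edge_primes) && top_primes.-nat a.

Lemma core_squarefree a : core a -> squarefree a.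
Proof. by case/andP => /andP[/asboolP]. Qed.

Lemma core_divisor a b : core (a * b) -> core a.
Proof.
case/andP => /andP[/asboolP sf aJ] pt; apply/andP; split; last first.
  by apply: pnat_dvd pt; exact: dvdn_mulr.
apply/andP; split.
  by apply/asboolP; apply: squarefree_dvd sf; exact: dvdn_mulr.
by apply/allP => p /(allP aJ); apply: contra => pa; exact: dvdn_mulr.
Qed.

Lemma core_prime a p (i : 'I_k) : (a <= X)%N -> core a -> prime p -> (p %| a)%N ->
  p%:R <= 2 * y i.+1 -> p%:R <= y i.+1.
Proof.
move=> aX /andP[/andP[/asboolP[a0 _] /allP aJ] _] pp pa pi.
rewrite leNgt; apply/negP => ip.
have : p \in edge_primes.
  rewrite mem_filter pp mem_index_iota ltnS prime_gt0 // (leq_trans (dvdn_leq a0 pa)) // !andbT.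
  by apply/existsP; exists i; rewrite ip.
by move/aJ; rewrite pa.
Qed.

(** The layers [(y_(i-1), y_i]] partition the primes up to [y_i]; the first starts at 1, below every
    prime. *)
Lemma prod_layer a i : (0 < a)%N -> (0 < i <= k)%N ->
  (\prod_(1 <= l < i.+1) a`_(layer l) = a`_(below i))%N.
Proof.
move=> a0; elim: i => // -[_ _|i IH ik].
  rewrite big_nat1; apply: eq_in_partn => p; rewrite mem_primes => /andP[pp _].
  by rewrite !inE /= /tprev /= ltr1n prime_gt1.
rewrite big_nat_recr //= IH; last by lia.
rewrite -[in RHS](partnC (below i.+1) (part_gt0 (below i.+2) a)) -!partnI.
congr (_ * _)%N; apply: eq_partn => p; rewrite !inE /= ?inE /=.
  apply/idP/andP => [pi|[_ //]]; split => //; apply: le_trans pi _; apply: y_incr; lia.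
by rewrite /tprev /= ltNge andbC.
Qed.

Lemma core_below a : (0 < a <= X)%N -> core a -> (a`_(below k) = a)%N.
Proof.
move=> /andP[a0 aX] ca; apply: part_pnat_id; apply/pnatP => // p pp pa.
have k1 : (k.-1 < k)%N by rewrite prednK.
have := @core_prime a p (Ordinal k1) aX ca pp pa; rewrite /= prednK // inE /=; apply.
case/andP: ca => _ /(pnatP _ a0) /(_ p pp pa); by rewrite inE.
Qed.

Variable c : R.
Definition typical a : bool :=
  [forall i : 'I_k, ln (a`_(layer i.+1))%N%:R <= c * ln (y i.+1)].

Lemma vec_ofE B (f : {ffun 'I_k -> 'I_B}) (i : 'I_k) : vec_of f i.+1 = f i.
Proof. by rewrite /vec_of /= (nth_map i) ?size_enum_ord // nth_ord_enum. Qed.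

(** The vector has entries [a_i], the part of [a] on the layer [i]. The bound on [Lk] follows
    because every admissible tuple for [a] satisfies the stepwise divisibility in [Lset]. *)
Lemma core_vector a : (0 < a <= X)%N -> core a -> typical a ->
  exists f : {ffun 'I_k -> 'I_(abound k y c)},
    [/\ Pstark k y (vec_of f),
        forall i, (1 <= i <= k)%N -> (vec_of f i)%:R <= y i `^ c,
        (\prod_(1 <= i < k.+1) vec_of f i = a)%N &
        (Ncells X S a)%:R * (ln 2 / 2) ^+ k <= Lk R k (vec_of f)].
Proof.
move=> aX ca ta; have /andP[a0 aX'] := aX.
have sz (i : 'I_k) : (a`_(layer i.+1))%N%:R <= y i.+1 `^ c.
  have yi : 1 < y i.+1 by apply: y_gt1; rewrite /= ltn_ord.
  rewrite -[leLHS]lnK ?posrE ?ltr0n ?part_gt0 // /powR gt_eqF ?(lt_trans _ yi) //.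
  by rewrite ler_expR; exact: (forallP ta i).
have bd (i : 'I_k) : (a`_(layer i.+1) < abound k y c)%N.
  rewrite ltnS; apply: (@leq_trans (Num.truncn (y i.+1 `^ c))).
    by rewrite truncn_ge_nat ?powR_ge0.
  rewrite (bigD1_seq i.+1) ?leq_addr ?iota_uniq //= mem_index_iota /= ltnS; exact: ltn_ord.
exists [ffun i : 'I_k => inord (a`_(layer i.+1))%N : 'I_(abound k y c)].
set v := vec_of _.
have vE i : (1 <= i <= k)%N -> v i = (a`_(layer i))%N.
  case: i => [//|i] ik; rewrite /v (vec_ofE _ (Ordinal ik)) ffunE inordK //.
have vP i : (0 < i <= k)%N -> (\prod_(1 <= l < i.+1) v l = a`_(below i))%N.
  move=> ik; rewrite -prod_layer //; apply: eq_big_nat => l; rewrite ltnS => lk.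
  by apply: vE; lia.
split.
- move=> i ik; rewrite vE //; split.
    by apply: squarefree_dvd (core_squarefree ca); exact: dvdn_part.
  move=> p pp pl; have := pnatP _ (part_gt0 _ a) (part_pnat (layer i) a) p pp pl.
  by rewrite inE /= => /andP[].
- move=> [//|i] ik; rewrite vE //; exact: (sz (Ordinal ik)).
- by rewrite vP ?k_gt0 ?leqnn // core_below.
apply: Lk_ge_card.
  by move=> i ik; rewrite vE // part_gt0.
move=> j; rewrite inE => /existsP[g /andP[ag /forallP Lg]].
have g0 i : (0 < g i)%N by exact: admissible_gt0 ag.
case/andP: ag => Dg /forallP Sg.
pose gg l : nat := if insub l is Some o then g o else 1%N.
have ggE (l : 'I_k) : gg l = g l by rewrite /gg valK.
exists gg => [l|i]; first by rewrite /gg; case: (insub l) => [w|] //; exact: g0.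
split; first by rewrite ggE (eqP (Lg i)).
rewrite vP; last by rewrite /= ltn_ord.
(* The partial product divides [a] and has only primes up to [y i.+1], so it divides the part of [a]
   below [y i.+1], which is the partial product of the vector. *)
have Da : (\prod_(0 <= l < i.+1) gg l %| a)%N.
  apply: dvdn_trans Dg; rewrite -(eq_bigr _ (fun l _ => ggE l)) -(big_mkord xpredT gg).
  by rewrite (@big_cat_nat _ _ _ i.+1 0 k) //= ?dvdn_mulr.
rewrite -[X in (X %| _)%N](@part_pnat_id (below i.+1)) ?partn_dvd //.
rewrite big_nat; apply: (big_ind (fun x => (below i.+1).-nat x)) => //.
  by move=> u v' pu pv; rewrite pnatM pu.
move=> l /andP[_ li]; have lk : (l < k)%N by apply: leq_trans (ltn_ord i).
rewrite (ggE (Ordinal lk)); apply/pnatP => // p pp pg; rewrite inE /=.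
have yl : y l.+1 <= y i.+1 by apply: y_mono.
apply: le_trans yl; apply: (@core_prime a p (Ordinal lk)) => //.
  apply: dvdn_trans Dg; apply: dvdn_trans pg _.
  by rewrite (bigD1 (Ordinal lk)) //= dvdn_mulr.
by apply: (allP (Sg (Ordinal lk))); rewrite mem_primes pp g0.
Qed.

Lemma Lk_ge0 a : 0 <= Lk R k a.
Proof. by apply: fine_ge0; exact: lebk_ge0. Qed.

Lemma sum_typical_le :
  (ln 2 / 2) ^+ k * \sum_(1 <= a < X.+1 | core a && typical a) wt R X S a <= Lsum k y c.
Proof.
pose Q (f : {ffun 'I_k -> 'I_(abound k y c)}) := asbool (Pstark k y (vec_of f) /\
                forall i, (1 <= i <= k)%N -> (vec_of f i)%:R <= y i `^ c).
pose phi (f : {ffun 'I_k -> 'I_(abound k y c)}) := (\prod_(1 <= i < k.+1) vec_of f i)%N.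
pose F a := (ln 2 / 2) ^+ k * wt R X S a.
(* The pointwise inequality is built into the range of summation, since it is known only for vectors
   coming from core integers. *)
pose Q' f := Q f && (F (phi f) <= Lk R k (vec_of f) / (phi f)%:R).
rewrite mulr_sumr.
apply: (@le_trans _ _ (\sum_(f | Q' f) F (phi f))).
  apply: (@sum_cover _ _ _ _ _ _ _ phi F); first exact: iota_uniq.
    by move=> a; rewrite mulr_ge0 ?wt_ge0 // exprn_ge0 // divr_ge0 // ltW // ln2_gt0.
  move=> a; rewrite mem_index_iota ltnS => aX /andP[ca ta].
  have [f [f1 f2 f3 f4]] := core_vector aX ca ta.
  exists f; first by rewrite mem_index_enum.
  split => //; apply/andP; split; first exact/asboolP.
  rewrite /phi f3 /F /wt mulrA ler_wpM2r ?invr_ge0 // mulrC //.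
rewrite /Lsum [leLHS]big_mkcond [leRHS]big_mkcond; apply: ler_sum => f _.
rewrite /Q' /Q; case: asboolP => //= _; case: ifP => // _.
by rewrite divr_ge0 ?Lk_ge0.
Qed.
End Link.

(** * Assembly *)

Section Assembly.
Variables (R : realType) (k : nat) (x : R) (y : nat -> R).
Hypothesis k_gt0 : (0 < k)%N.
Hypothesis x_ge1 : 1 <= x.
Hypothesis y1 : expR 1 <= y 1%N.
Hypothesis y_incr : forall i, (1 <= i < k)%N -> y i <= y i.+1.
Hypothesis yx : 2 ^+ k * \prod_(1 <= i < k.+1) y i <= x / y k.

Local Notation X := (Num.truncn x).
Local Notation Y := (fun i : 'I_k => y i.+1).
Local Notation S := (smooth_for Y).
Local Notation W := (wt R X S).

Let e_ge2 : 2 <= expR 1 :> R.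
Proof. by have := @expR_ge1Dx R 1; lra. Qed.

Let y_ge_e i : (1 <= i <= k)%N -> expR 1 <= y i.
Proof. by case/andP => i1 ik; apply: (le_trans y1); exact: (y_mono y_incr). Qed.

Let y_ge2 i : (1 <= i <= k)%N -> 2 <= y i.
Proof. by move=> /y_ge_e; have := e_ge2; lra. Qed.

Let y_gt0 i : (1 <= i <= k)%N -> 0 < y i.
Proof. by move=> /y_ge2; lra. Qed.

Let ln_y_ge1 i : (1 <= i <= k)%N -> 1 <= ln (y i).
Proof.
by move=> ik; rewrite -[leLHS](@expRK R) ler_ln ?posrE ?expR_gt0 ?y_gt0 ?y_ge_e.
Qed.

Let kk : (1 <= k <= k)%N. Proof. by rewrite k_gt0 leqnn. Qed.

Let ordk (i : 'I_k) : (1 <= i.+1 <= k)%N. Proof. by rewrite /= ltn_ord. Qed.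

(** An atypical [a] has a large part on some layer. With this [c], Markov's inequality gives each of
    the [k] layers at most [1 / (2k)] of the total, so typical integers carry at least half. *)
Lemma sum_core_le (c : R) : c = 4 * k%:R * 4 ^+ k ->
  \sum_(1 <= a < X.+1 | core k y X a) W a <=
  2 * \sum_(1 <= a < X.+1 | core k y X a && typical k y c a) W a.
Proof.
move=> cE; set T := (X in X <= _); set G := \sum_(1 <= a < _ | _) _.
have k0 : 0 < k%:R :> R by rewrite ltr0n.
have f0 : 0 < 4 ^+ k :> R by rewrite exprn_gt0.
have c0 : 0 < c by rewrite cE !mulr_gt0.
have T0 : 0 <= T by apply: sumr_ge0 => *; exact: wt_ge0.
suff : T - G <= T / 2 by lra.
have -> : T - G = \sum_(1 <= a < X.+1 | core k y X a && ~~ typical k y c a) W a.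
  by rewrite /T (bigID (typical k y c)) /= addrAC subrr add0r.
apply: (@le_trans _ _ (\sum_(i < k) \sum_(1 <= a < X.+1 |
    core k y X a && (c * ln (y i.+1) < ln (a`_(layer y i.+1))%N%:R)) W a)).
  under [leRHS]eq_bigr do rewrite big_mkcond.
  rewrite [leRHS]exchange_big /= [leLHS]big_mkcond; apply: ler_sum => a _.
  have pos (i : 'I_k) : 0 <= (if core k y X a &&
    (c * ln (y i.+1) < ln (a`_(layer y i.+1))%N%:R) then W a else 0).
    by case: ifP => // _; rewrite wt_ge0.
  case: ifP => [/andP[ca /forallPn[i]]|_]; last by apply: sumr_ge0.
  rewrite -ltNge => ci; rewrite (bigD1 i) //= ca ci /= lerDl.
  by apply: sumr_ge0 => l _; case: ifP => // _; exact: wt_ge0.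
apply: (@le_trans _ _ (\sum_(i < k) (2 * k%:R)^-1 * T)); last first.
  rewrite sumr_const card_ord -[leLHS]mulr_natl le_eqVlt; apply/orP; left; apply/eqP.
  by field; lra.
apply: ler_sum => i _.
have Ly := ln_y_ge1 (ordk i).
apply: le_trans (@sum_wt_large_part R k X S (layer y i.+1) (core k y X) (Num.truncn (y i.+1))
  (c * ln (y i.+1)) _ _ _ _) _.
- by rewrite mulr_gt0 //; lra.
- by move=> a; exact: core_squarefree.
- by move=> a b; exact: core_divisor.
- by move=> p; rewrite inE => /andP[_ py]; rewrite truncn_ge_nat // ltW // y_gt0.
rewrite -/T ler_wpM2r //.
have LM : ln (Num.truncn (y i.+1))%:R <= ln (y i.+1).
  rewrite ler_ln ?posrE ?y_gt0 // ?truncn_le ?(ltW (y_gt0 _)) //.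
  by rewrite ltr0n truncn_gt0; have := y_ge2 (ordk i); lra.
set L := ln (y i.+1) in Ly LM *.
apply: (@le_trans _ _ (4 ^+ k / (c * L) * (2 * L))).
  by rewrite ler_wpM2l ?divr_ge0 ?mulr_ge0 ?(ltW f0) ?(ltW c0) //; lra.
rewrite le_eqVlt; apply/orP; left; apply/eqP.
by rewrite cE; field; rewrite !gt_eqF //; lra.
Qed.

Let D0 : R := 2 ^+ k * \prod_(1 <= i < k.+1) y i.

Let D0_gt0 : 0 < D0.
Proof.
rewrite mulr_gt0 ?exprn_gt0 // big_nat prodr_gt0 // => i; exact: y_gt0.
Qed.

Let D0E : D0 = \prod_(i < k) (2 * y i.+1).
Proof.
by rewrite /D0 big_add1 big_mkord big_split /= prodr_const card_ord.
Qed.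

Let x_gt0 : 0 < x. Proof. exact: lt_le_trans ltr01 x_ge1. Qed.

(** The least cofactor when [n] is near [x], since every [d_i <= 2 y_i]; the hypothesis on [x] says
    that [t >= y_k]. *)
Let t := x / D0.

Let t_ge : y k <= t.
Proof.
have := yx; rewrite -/D0 ler_pdivlMr ?y_gt0 // => H.
by rewrite /t ler_pdivlMr // mulrC.
Qed.

Let t_gt0 : 0 < t. Proof. exact: lt_le_trans (y_gt0 kk) t_ge. Qed.

Let ln_t : ln (y k) <= ln t.
Proof. by rewrite ler_ln ?posrE ?y_gt0. Qed.

(** [x = t D0] and [D0 <= y_k ^ (2k)], because [2 <= y_k]. *)
Let ln_x_le : ln x <= (2 * k%:R + 1) * ln t.
Proof.
have -> : x = t * D0 by rewrite /t divfK // gt_eqF.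
rewrite lnM ?posrE // mulrDl mul1r addrC lerD2r.
apply: (@le_trans _ _ (2 * k%:R * ln (y k))); last by rewrite ler_wpM2l ?mulr_ge0.
apply: (@le_trans _ _ (ln ((y k ^+ 2) ^+ k))); last first.
  by rewrite -exprM lnXn ?y_gt0 // -[leLHS]mulr_natl natrM.
rewrite ler_ln ?posrE ?exprn_gt0 ?y_gt0 // D0E.
have -> : (y k ^+ 2) ^+ k = \prod_(i < k) y k ^+ 2 by rewrite prodr_const card_ord.
apply: ler_prod => i _; have := y_gt0 (ordk i); have := y_ge2 kk.
have : y i.+1 <= y k by apply: (y_mono y_incr).
rewrite expr2 => h1 h2 h3; apply/andP; split; first by lra.
apply: ler_pM => //; lra.
Qed.

Lemma ln_y_le_ln_x : ln (y k) <= ln x.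
Proof.
rewrite ler_ln ?posrE ?y_gt0 //; apply: le_trans t_ge _.
rewrite /t ler_pdivrMr // ler_peMr //; first exact: ltW.
rewrite D0E; apply: (@big_ind _ (fun u => 1 <= u)) => // [u v u1 v1|i _].
  by rewrite -[leLHS]mulr1 ler_pM.
by have := y_ge2 (ordk i); lra.
Qed.

(** The square root of [y_k]. *)
Let s := expR (ln (y k) / 2).

Let P := \prod_(i < k) ln (y i.+1).

Let P_gt0 : 0 < P.
Proof. by apply: prodr_gt0 => i _; apply: lt_le_trans (ln_y_ge1 (ordk i)). Qed.

(** Integers up to [x / s] are counted trivially. For larger [n] the cofactor is at least [t / s],
    whose logarithm is at least [ln t / 2], hence at least [ln x / (4k + 2)]; dividing the first
    moment by this and by [P] bounds the count. *)
Lemma Hcount_le :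
  (Hcount k x y (fun i => 2 * y i))%:R <=
  x / s + (4 * k%:R + 2) * (4 * 16 ^+ k) * x / (ln x * P) * \sum_(1 <= m < X.+1) W m.
Proof.
have s0 : 0 < s by exact: expR_gt0.
have lx0 : 0 < ln x by have := ln_y_ge1 kk; have := ln_y_le_ln_x; lra.
have k0 : 0 <= k%:R :> R by [].
rewrite /Hcount -sum1_count natr_sum.
have -> : iota 1 X = index_iota 1 X.+1 by rewrite /index_iota subSS subn0.
rewrite (bigID (fun n : nat => n%:R <= x / s)) /= lerD //.
  apply: le_trans (@sum_le_real R X (x / s) _); last by rewrite divr_ge0 // ltW.
  rewrite [leLHS]big_mkcond [leRHS]big_mkcond; apply: ler_sum => n _.
  by case: ifP => [/andP[_ ->] //|_]; case: ifP.
set N1 := \sum_(_ <= _ < _ | _) _.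
have key : ln x / (4 * k%:R + 2) * P * N1 <= 4 * 16 ^+ k * x * \sum_(1 <= m < X.+1) W m.
  apply: (@le_trans _ _ (4 * 16 ^+ k * X%:R * \sum_(1 <= m < X.+1) W m)); last first.
    apply: ler_wpM2r; first by apply: sumr_ge0 => m _; exact: wt_ge0.
    by rewrite ler_wpM2l ?mulr_ge0 ?exprn_ge0 // truncn_le ltW.
  have Y1 (i : 'I_k) : 1 < Y i by have := y_ge2 (ordk i); lra.
  apply: le_trans (sum_factored_le X Y1).
  rewrite /N1 mulr_sumr big_mkcond /= !big_nat; apply: ler_sum => n /andP[n0 nX].
  case: ifP => [/andP[An zn]|_]; last first.
    apply: sumr_ge0 => q0 _; apply: sumr_ge0 => q _.
    by rewrite mulr_ge0 ?mangoldt_ge0 // prodr_ge0 // => i _; exact: mangoldt_ge0.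
  rewrite mulr1; case/existsP: An => d /andP[Dn /forallP yd].
  rewrite -ltNge in zn; rewrite ltnS in nX.
  pose d' : {ffun 'I_k -> 'I_X.+1} := [ffun i => inord (d i)].
  have d'E i : d' i = d i :> nat.
    by rewrite ffunE inordK // ltnS (leq_trans _ nX) // -ltnS.
  have DE : (\prod_i (d' i : nat) = \prod_i (d i : nat))%N by apply: eq_bigr => i _.
  have := @ln_factors_le R k X Y n d'; rewrite n0 nX DE => /(_ isT Dn) H.
  apply: le_trans (H _) => [|i]; last first.
    by rewrite d'E; have /andP[/andP[_ ->] ->] := yd i.
  set D := (\prod_i (d i : nat))%N in Dn DE *.
  have Dpos : (0 < D)%N by exact: dvdn_gt0 Dn.
  have DD0 : D%:R <= D0.
    rewrite D0E /D natr_prod; apply: ler_prod => i _.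
    by rewrite ler0n /=; have /andP[_ ->] := yd i.
  have fE : (n %/ D)%N%:R = n%:R / D%:R :> R.
    by rewrite -[in RHS](divnK Dn) natrM mulfK // gt_eqF ?ltr0n.
  have f_ge : t / s <= (n %/ D)%N%:R.
    rewrite fE /t mulrAC ler_pM ?divr_ge0 ?invr_ge0 ?(ltW x_gt0) ?(ltW s0) ?(ltW D0_gt0) ?(ltW zn) //.
    by rewrite lef_pV2 ?posrE ?ltr0n.
  have ts0 : 0 < t / s by rewrite divr_gt0.
  have lf : ln x / (4 * k%:R + 2) <= ln (n %/ D)%N%:R.
    apply: (@le_trans _ _ (ln (t / s))); last by rewrite ler_ln ?posrE ?(lt_le_trans ts0).
    rewrite ln_div ?posrE // /s expRK ler_pdivrMr; last by lra.
    have := ln_x_le; have := ln_t; nra.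
  apply: ler_pM => //; [by rewrite divr_ge0 ?(ltW lx0) //; lra|exact: ltW|].
  apply: ler_prod => i _; rewrite (le_trans ler01 (ln_y_ge1 (ordk i))) /=.
  have /andP[/andP[di0 yi] _] := yd i.
  by rewrite d'E ler_ln ?posrE ?y_gt0 ?ltr0n // ltW.
have q0 : 0 < ln x / (4 * k%:R + 2) * P by rewrite mulr_gt0 ?divr_gt0 //; lra.
rewrite -(ler_pM2l q0); apply: le_trans key _.
rewrite le_eqVlt; apply/orP; left; apply/eqP; field.
by rewrite !gt_eqF //; lra.
Qed.

Lemma sum_edge_primes_le : \sum_(p <- edge_primes k y X) (p%:R^-1 : R) <= 2 * k%:R.
Proof.
apply: (@le_trans _ _ (\sum_(i < k) \sum_(1 <= p < X.+1 | y i.+1 < p%:R <= 2 * y i.+1) (p%:R^-1 : R))).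
  rewrite big_filter [leLHS]big_mkcond; under [leRHS]eq_bigr do rewrite big_mkcond.
  rewrite [leRHS]exchange_big /=; apply: ler_sum => p _.
  have pos (i : 'I_k) : 0 <= (if y i.+1 < p%:R <= 2 * y i.+1 then p%:R^-1 else 0 : R).
    by case: ifP => // _; rewrite invr_ge0.
  case: ifP => [/andP[_ /existsP[i yi]]|_]; last by apply: sumr_ge0.
  by rewrite (bigD1 i) //= yi lerDl; apply: sumr_ge0.
apply: (@le_trans _ _ (\sum_(i < k) (2 : R))); last by rewrite sumr_const card_ord mulr_natr.
by apply: ler_sum => i _; apply: sum_inv_dyadic_le; exact: y_gt0.
Qed.

(** Multiplying by the harmonic sum up to [y_k], at least [ln y_k], gives at most
    [1 + ln x + ln y_k <= 3 ln x]. *)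
Lemma sum_rough_top_le :
  \sum_(1 <= b < X.+1 | (top_primes k y)^'.-nat b) (b%:R^-1 : R) <= 3 * ln x / ln (y k).
Proof.
have ly := ln_y_ge1 kk; have y2 := y_ge2 kk.
rewrite ler_pdivlMr ?(lt_le_trans ltr01 ly) // mulrC.
set Z := Num.truncn (y k); set B := \sum_(_ <= _ < _ | _) _.
have B0 : 0 <= B by apply: sumr_ge0 => b _; rewrite invr_ge0.
have Z0 : (0 < Z)%N by rewrite truncn_gt0; lra.
have X0 : (0 < X)%N by rewrite truncn_gt0.
have Zy : Z%:R <= y k by rewrite truncn_le; lra.
apply: (@le_trans _ _ ((\sum_(1 <= a < Z.+1) a%:R^-1) * B)).
  rewrite ler_wpM2r //; apply: le_trans (ln_le_sum_inv R Z).
  by rewrite ler_ln ?posrE ?ltr0n ?y_gt0 // ltW // truncnS_gt.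
apply: (@le_trans _ _ (\sum_(1 <= n < (X * Z).+1) n%:R^-1)).
  apply: sum_rough_le => p pZ; rewrite inE /=.
  apply: (@le_trans _ _ (y k)); last by lra.
  by apply: le_trans Zy; rewrite ler_nat.
apply: le_trans (sum_inv_le R _) _; first by rewrite muln_gt0 X0.
rewrite natrM lnM ?posrE ?ltr0n //.
have lX : ln X%:R <= ln x by rewrite ler_ln ?posrE ?ltr0n // truncn_le ltW.
have lZ : ln Z%:R <= ln (y k) by rewrite ler_ln ?posrE ?ltr0n ?y_gt0.
have := ln_y_le_ln_x; lra.
Qed.

Lemma sum_wt_core_le :
  \sum_(1 <= m < X.+1) W m <=
  2 ^+ k * 2 ^+ (2 ^ (2 * k)) * (expR (4 ^+ k * (2 * k%:R)) *
    (3 * ln x / ln (y k) * \sum_(1 <= a < X.+1 | core k y X a) W a)).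
Proof.
apply: le_trans (sum_wt_squarefree _ _ _) _.
apply: ler_wpM2l; first by rewrite mulr_ge0 ?exprn_ge0.
apply: le_trans (@sum_wt_avoid R k X S (edge_primes k y X) _) _.
  by apply/allP => p; rewrite mem_filter => /andP[/andP[]].
apply: ler_pM; rewrite ?expR_ge0 //.
- by apply: sumr_ge0 => *; exact: wt_ge0.
- by rewrite ler_expR ler_wpM2l ?exprn_ge0 // sum_edge_primes_le.
apply: le_trans (@sum_wt_rough R k X S (top_primes k y) _ _ _) _.
- move=> i p; rewrite /smooth_for inE /= => /le_trans; apply.
  by rewrite ler_pM2l //; apply: (y_mono y_incr).
- move=> a b /andP[/asboolP sf aJ]; apply/andP; split.
    by apply/asboolP; apply: squarefree_dvd sf; exact: dvdn_mulr.
  by apply/allP => p /(allP aJ); apply: contra => pa; exact: dvdn_mulr.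
by apply: ler_wpM2r sum_rough_top_le; apply: sumr_ge0 => *; exact: wt_ge0.
Qed.

(** The term [a = 1] alone suffices; this lets the main sum absorb the error [x / s]. *)
Lemma sum_core_ge1 : 1 <= \sum_(1 <= a < X.+1 | core k y X a) W a.
Proof.
have X0 : (0 < X)%N by rewrite truncn_gt0.
rewrite big_ltn_cond // ifT; last first.
  apply/andP; split => //; apply/andP; split.
    apply/asboolP; split => // p pp; rewrite dvdn1 muln_eq1 andbb.
    by move/eqP => p1; rewrite p1 in pp.
  apply/allP => p; rewrite mem_filter => /andP[/andP[pp _] _].
  by rewrite dvdn1; apply: contraTN pp => /eqP ->.
rewrite -[leLHS]addr0 lerD //; last by apply: sumr_ge0 => *; exact: wt_ge0.
by rewrite /wt invr1 mulr1 ler1n Ncells_gt0.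
Qed.

Lemma prod_ln_ek : \prod_(1 <= i < k.+1) ln (y i) ^- ek k i = (P * ln (y k))^-1.
Proof.
rewrite /P; case: (k) k_gt0 => // n _.
rewrite big_nat_recr //= big_ord_recr /= /ek eqxx.
rewrite !invfM -[RHS]mulrA -invfM -expr2; congr (_ * _).
rewrite big_add1 /= big_mkord -prodfV; apply: eq_bigr => i _.
by rewrite ltn_eqF ?expr1 // ltnS.
Qed.

(** The left side is at most [(ln y_k) ^ (k + 1)], and [v <= expR v] at [v = ln y_k / (2 (k + 1))]
    compares this with the square root of [y_k]. *)
Lemma prod_ln_le : P * ln (y k) <= (2 * k.+1%:R) ^+ k.+1 * s.
Proof.
have ly := ln_y_ge1 kk.
apply: (@le_trans _ _ (ln (y k) ^+ k.+1)).
  rewrite exprSr ler_wpM2r //; first by lra.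
  have -> : ln (y k) ^+ k = \prod_(i < k) ln (y k) by rewrite prodr_const card_ord.
  apply: ler_prod => i _; have := ln_y_ge1 (ordk i) => l1.
  rewrite (le_trans ler01 l1) /= ler_ln ?posrE ?y_gt0 //.
  by apply: (y_mono y_incr).
have m0 : 0 < 2 * k.+1%:R :> R by rewrite mulr_gt0.
have -> : s = expR (ln (y k) / (2 * k.+1%:R)) ^+ k.+1.
  rewrite /s -expRM_natl; congr expR; field.
  by rewrite gt_eqF // ltr0n.
rewrite -exprMn lerXn2r ?nnegrE ?mulr_ge0 ?expR_ge0 ?(ltW m0) //; first by lra.
rewrite mulrC -ler_pdivrMr //; apply: le_trans (expR_ge1Dx _).
by rewrite lerDr.
Qed.
End Assembly.

Theorem theorem3p9 (R : realType) (k : nat) (hk : (1 <= k)%N) :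
  exists (C' c K : R), forall (x : R) (y : nat -> R),
    1 <= x ->
    C' <= y 1%N ->
    (forall i : nat, (1 <= i < k)%N -> y i <= y i.+1) ->
    2 ^+ k * \prod_(1 <= i < k.+1) y i <= x / y k ->
    (Hcount k x y (fun i => 2 * y i))%:R / x <=
      K * (\prod_(1 <= i < k.+1) (ln (y i)) ^- (ek k i)) * Lsum k y c.
Proof.
(* [c] is the Markov threshold, [A] collects the constants of the reductions, [B] that of the error
   term, and [c0] is the volume guaranteed per cell. The bound [expR 1] on [y 1] makes every
   [ln y_i] at least 1. *)
pose c : R := 4 * k%:R * 4 ^+ k.
pose A : R := (4 * k%:R + 2) * (4 * 16 ^+ k) *
  (2 ^+ k * 2 ^+ (2 ^ (2 * k)) * (expR (4 ^+ k * (2 * k%:R)) * 3)).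
pose B : R := (2 * k.+1%:R) ^+ k.+1.
pose c0 : R := (ln 2 / 2) ^+ k.
exists (expR 1), c, ((B + A) * (2 / c0)) => x y x1 y1 y_incr yx.
have c00 : 0 < c0 by rewrite exprn_gt0 // divr_gt0 // ln2_gt0.
have A0 : 0 <= A.
  by rewrite !mulr_ge0 ?exprn_ge0 ?expR_ge0 ?addr_ge0 ?mulr_ge0 ?exprn_ge0.
have B0 : 0 <= B by rewrite exprn_ge0 // mulr_ge0.
have x0 : 0 < x by lra.
have e2 : 2 <= expR 1 :> R by have := @expR_ge1Dx R 1; lra.
have y11 : 1 < y 1%N by lra.
set X := Num.truncn x.
set T := \sum_(1 <= a < X.+1 | core k y X a) wt R X (smooth_for (fun i : 'I_k => y i.+1)) a.
have T1 : 1 <= T by exact: sum_core_ge1.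
have TL : T <= 2 / c0 * Lsum k y c.
  apply: le_trans (sum_core_le x hk y1 y_incr (erefl c)) _.
  rewrite -mulrA ler_pM2l // ler_pdivlMl //.
  exact: sum_typical_le.
have ln1 i : (1 <= i <= k)%N -> 1 <= ln (y i).
  move=> /andP[i1 ik]; have yi := le_trans y1 (y_mono y_incr (leqnn 1) i1 ik).
  by rewrite -[leLHS](@expRK R) ler_ln ?posrE ?expR_gt0 // (lt_le_trans (expR_gt0 1)).
have l1 : 1 <= ln (y k) by rewrite ln1 // hk leqnn.
have := Hcount_le hk x1 y1 y_incr yx; have := prod_ln_le hk y1 y_incr.
rewrite prod_ln_ek // -/B; set P : R := \prod_(i < k) ln (y i.+1).
set s := expR _; set l := ln (y k) in l1 *; set H := _%:R => PB HB.
have s0 : 0 < s by exact: expR_gt0.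
have P0 : 0 < P by apply: prodr_gt0 => i _; rewrite (lt_le_trans ltr01) // ln1 //= ltn_ord.
have l0 : 0 < l by exact: lt_le_trans l1.
have lx0 : 0 < ln x by exact: lt_le_trans l0 (ln_y_le_ln_x hk x1 y1 y_incr yx).
have Pl0 : 0 < P * l by rewrite mulr_gt0.
have {}HB : H <= x * (s^-1 + A * T / (P * l)).
  apply: le_trans HB _; rewrite mulrDr lerD2l.
  apply: le_trans (ler_wpM2l _ (sum_wt_core_le hk x1 y1 y_incr yx)) _.
    by rewrite divr_ge0 ?mulr_ge0 ?addr_ge0 ?mulr_ge0 ?exprn_ge0 ?(ltW x0) ?(ltW lx0) ?(ltW P0).
  rewrite -/X -/T -/l /A le_eqVlt; apply/orP; left; apply/eqP; field.
  by rewrite !gt_eqF.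
(* The error term has the size of the main term because [T >= 1]. *)
have sB : s^-1 <= B * T / (P * l).
  rewrite ler_pdivlMr // mulrC ler_pdivrMr //; apply: le_trans PB _.
  by rewrite ler_wpM2r ?(ltW s0) // ler_peMr.
apply: (@le_trans _ _ ((B + A) * T / (P * l))).
  rewrite ler_pdivrMr // mulrC; apply: le_trans HB _.
  by rewrite ler_pM2l // mulrDl mulrDl lerD2r.
have -> : (B + A) * (2 / c0) / (P * l) * Lsum k y c =
    (B + A) * (2 / c0 * Lsum k y c) / (P * l) by ring.
by rewrite ler_wpM2r ?invr_ge0 ?(ltW Pl0) // ler_wpM2l // addr_ge0.
Qed.
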